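(* Let $P$ be a non-$\Sigma$ operad in $\mathcal{C}$, $A$ a $P$-algebra in $\mathcal{D}$, $M$ an $A$-bimodule, and $R:({}^{0}\!\mathbf{\Delta}C_P)^{op}\to\mathcal{C}$ a $\mathcal{C}$-functor. Then $R$-cotraces on $(A,M)$ are represented by $Hom_{{}^{0}\!\mathbf{\Delta}C_P}(R,C^\bullet_{cy}(A;M))$: there is a bijection, natural in the object $B$ of $\mathcal{D}$, between $R$-cotraces on $(A,M)$ with source $B$ and morphisms $B\to Hom_{{}^{0}\!\mathbf{\Delta}C_P}(R,C^\bullet_{cy}(A;M))$ in $\mathcal{D}$.
   Context: $\mathcal{C}$ is a closed symmetric monoidal category with unit $I$ and $\mathcal{D}$ is a closed symmetric monoidal $\mathcal{C}$-category (enriched, tensored and cotensored over $\mathcal{C}$, compatibly with its symmetric monoidal structure); both have countable limits and colimits. All tensor products (including tensors of objects of $\mathcal{D}$ with objects of $\mathcal{C}$) are written $\otimes$; $Hom(X,Y)$ denotes the internal hom of $\mathcal{D}$ for $X,Y\in\mathcal{D}$ and the cotensor for $X\in\mathcal{C}$, $Y\in\mathcal{D}$. A non-$\Sigma$ operad $P$ (with a zeroth object $P(0)$) assigns an object $P(S)$ to each finite linearly ordered set $S$ (functorially in order isomorphisms), with associative and unital structure maps $P(T)\otimes P[f]\to P(S)$ for order-preserving $f:S\to T$, where $P[f]=\bigotimes_{t\in T}P(f^{-1}(t))$, and unit $I\to P(1)$. A $P$-algebra $A$ has structure maps $P(S)\otimes A^{\otimes S}\to A$. An $A$-bimodule $M$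 has structure maps $P(n)\otimes A^{\otimes i-1}\otimes M\otimes A^{\otimes n-i}\to M$ for $n\ge1$, $1\le i\le n$, satisfying the usual associativity and unit conditions. ${}^{0}\!\mathbf{\Delta}C$ is the category of finite cyclically ordered sets with basepoint $0$; a morphism $S\to T$ is a basepoint-preserving map $f$ together with a linear ordering of each fiber such that the cyclic order of $S$ is the concatenation of the ordered fibers in the cyclic order of $T$; composites have fibers ordered by concatenation. We use the skeleton with one object of each cardinality $\geq 1$. ${}^{0}\!\mathbf{\Delta}C_P$ is the $\mathcal{C}$-category with the same objects, $Hom(S,T)=\coprod_{f:S\to T}P[f]$ (coproduct over morphisms of ${}^{0}\!\mathbf{\Delta}C$), and composition induced by the operad structure. Thus $R$ has structure maps $R(T)\otimes P[f]\to R(S)$. The factors of $A^{\otimes S-\{0\}}$ are ordered by the linear order of $S-\{0\}$ obtained by cutting the cyclic order at $0$. For $f:S\to T$ in ${}^{0}\!\mathbf{\Delta}C$ and an object $X$ of $\mathcal{D}$, a map $\phi:X\otimes A^{\otimes T-\{0\}}\to M$ determines a map $$\phi_f:\ P[f]\otimes X\otimes A^{\otimes S-\{0\}}\to M$$ as follows: apply the algebra structure maps $P(f^{-1}(t))\otimes A^{\otimes f^{-1}(t)}\to A$ for $t\ne 0$; then apply $\phi$ to $X$ and the resulting factors $A^{\otimes T-\{0\}}$; then apply the bimodule structure map $P(f^{-1}(0))\otimes A^{\otimes L_>}\otimes M\otimes A^{\otimes L_<}\to M$, where $L_>$ (resp. $L_<$) is the set of elements of $f^{-1}(0)$ that are greater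 (resp. less) than $0$ in the linear order of $f^{-1}(0)$. (So the linear order of the $A$-factors of $A^{\otimes S-\{0\}}$ is kept; no cyclic permutation occurs.) An $R$-cotrace on $(A,M)$ with source $B$ is a family of maps $\tau_S:R(S)\otimes B\otimes A^{\otimes S-\{0\}}\to M$, $S\in{}^{0}\!\mathbf{\Delta}C$, such that for every $f:S\to T$ the composite $$R(T)\otimes P[f]\otimes B\otimes A^{\otimes S-\{0\}}\to R(S)\otimes B\otimes A^{\otimes S-\{0\}}\xrightarrow{\tau_S}M$$ equals (up to the symmetry isomorphism) $(\tau_T)_f$ with $X=R(T)\otimes B$. The cyclic cobar construction is $C^\bullet_{cy}(A;M)(S)=Hom(A^{\otimes S-\{0\}},M)$, with structure maps $C^\bullet_{cy}(A;M)(T)\otimes P[f]\to C^\bullet_{cy}(A;M)(S)$ adjoint to $\mathrm{ev}_f$, where $\mathrm{ev}:Hom(A^{\otimes T-\{0\}},M)\otimes A^{\otimes T-\{0\}}\to M$ is evaluation. Writing $F=C^\bullet_{cy}(A;M)$, the object $Hom_{{}^{0}\!\mathbf{\Delta}C_P}(R,F)$ of $\mathcal{D}$ is the equalizer of the two maps $$\prod_{S}Hom(R(S),F(S))\rightrightarrows\prod_{f:S\to T}Hom(R(T)\otimes P[f],F(S))$$ given by precomposition with $R(T)\otimes P[f]\to R(S)$, and by $Hom(R(T),F(T))\to Hom(R(T)\otimes P[f],F(T)\otimes P[f])\to Hom(R(T)\otimes P[f],F(S))$, respectively. *)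

(* Defs.v *)
From HB Require Import structures.
From mathcomp Require Import all_boot.

Set Implicit Arguments.
Unset Strict Implicit.
Unset Printing Implicit Defensive.

Declare Scope moncat_scope.
Delimit Scope moncat_scope with mc.
Local Open Scope moncat_scope.

Reserved Notation "g ∘ f" (at level 50, left associativity).
Reserved Notation "x ⊗ y" (at level 40, left associativity).
Reserved Notation "f ⊗₁ g" (at level 40, left associativity).
Reserved Notation "c ⊳ x" (at level 40, left associativity).
Reserved Notation "h ⊳₁ f" (at level 40, left associativity).

Record category := Category {
  ob :> Type;
  hom : ob -> ob -> Type;
  idm : forall x, hom x x;
  cmp : forall x y z, hom y z -> hom x y -> hom x z;
  cmp1m : forall x y (f : hom x y), cmp (idm y) f = f;
  cmpm1 : forall x y (f : hom x y), cmp f (idm x) = f;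
  cmpA : forall x y z w (h : hom z w) (g : hom y z) (f : hom x y),
    cmp h (cmp g f) = cmp (cmp h g) f
}.
Arguments hom {c} x y.
Arguments idm {c} x.
Arguments cmp {c x y z} g f.
Notation "g ∘ f" := (cmp g f) : moncat_scope.

Record functor (J K : category) := Functor {
  fob :> J -> K;
  fmap : forall i j : J, hom i j -> hom (fob i) (fob j);
  fmap1 : forall i, fmap (idm i) = idm (fob i);
  fmap_cmp : forall i j k (v : hom j k) (u : hom i j),
    fmap (v ∘ u) = fmap v ∘ fmap u
}.

Record countable_category := CountableCategory {
  cc_ob : countType;
  cc_hom : cc_ob -> cc_ob -> countType;
  cc_id : forall x, cc_hom x x;
  cc_cmp : forall x y z, cc_hom y z -> cc_hom x y -> cc_hom x z;
  cc_cmp1m : forall x y (f : cc_hom x y), cc_cmp (cc_id y) f = f;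
  cc_cmpm1 : forall x y (f : cc_hom x y), cc_cmp f (cc_id x) = f;
  cc_cmpA : forall x y z w (h : cc_hom z w) (g : cc_hom y z) (f : cc_hom x y),
    cc_cmp h (cc_cmp g f) = cc_cmp (cc_cmp h g) f
}.

Coercion category_of (J : countable_category) : category :=
  Category (@cc_cmp1m J) (@cc_cmpm1 J) (@cc_cmpA J).

Record limit (J K : category) (F : functor J K) := Limit {
  lim_ob : K;
  lim_pr : forall j, hom lim_ob (F j);
  lim_cone : forall i j (u : hom i j), fmap F u ∘ lim_pr i = lim_pr j;
  lim_lift : forall (x : K) (p : forall j, hom x (F j)),
    (forall i j (u : hom i j), fmap F u ∘ p i = p j) -> hom x lim_ob;
  lim_liftE : forall x p pP j, lim_pr j ∘ @lim_lift x p pP = p j;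
  lim_uniq : forall x (f g : hom x lim_ob),
    (forall j, lim_pr j ∘ f = lim_pr j ∘ g) -> f = g
}.

Record colimit (J K : category) (F : functor J K) := Colimit {
  colim_ob : K;
  colim_in : forall j, hom (F j) colim_ob;
  colim_cocone : forall i j (u : hom i j), colim_in j ∘ fmap F u = colim_in i;
  colim_desc : forall (x : K) (p : forall j, hom (F j) x),
    (forall i j (u : hom i j), p j ∘ fmap F u = p i) -> hom colim_ob x;
  colim_descE : forall x p pP j, @colim_desc x p pP ∘ colim_in j = p j;
  colim_uniq : forall x (f g : hom colim_ob x),
    (forall j, f ∘ colim_in j = g ∘ colim_in j) -> f = g
}.

Definition countable_limits (K : category) :=
  forall (J : countable_category) (F : functor J K), limit F.
Definition countable_colimits (K : category) :=
  forall (J : countable_category) (F : functor J K), colimit F.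

Section Discrete.
Variable T : countType.

Definition disc_hom (x y : T) : countType := {u : unit | x == y}.

Lemma disc_hom_irr x y (u v : disc_hom x y) : u = v.
Proof. by apply: val_inj; case: (val u) (val v) => [] []. Qed.

Definition disc : countable_category.
Proof.
refine (@CountableCategory T disc_hom (fun x => exist _ tt (eqxx x))
  (fun x y z v u => exist _ tt (introT eqP
     (etrans (elimT eqP (valP u)) (elimT eqP (valP v))))) _ _ _);
by move=> *; apply: disc_hom_irr.
Defined.

Variables (K : category) (X : T -> K).

Definition disc_map (x y : disc) (u : hom x y) : hom (X x) (X y) :=
  match elimT eqP (valP u) in _ = z return hom (X x) (X z) with
  | erefl => idm (X x) end.

Lemma disc_map1 x (u : @hom disc x x) : disc_map u = idm (X x).
Proof. by rewrite /disc_map (eq_irrelevance (elimT eqP (valP u)) (erefl x)). Qed.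

Definition disc_functor : functor disc K.
Proof.
refine (@Functor disc K X disc_map (fun i => disc_map1 _) _).
move=> i j k v u; have ej : j = k := elimT eqP (valP v); subst k.
have ei : i = j := elimT eqP (valP u); subst j.
by rewrite !disc_map1 cmp1m.
Defined.

Lemma disc_cone x (p : forall t, hom x (X t)) i j (u : @hom disc i j) :
  fmap disc_functor u ∘ p i = p j.
Proof.
have ei : i = j := elimT eqP (valP u); subst j.
by rewrite [fmap _ _]disc_map1 cmp1m.
Qed.

Lemma disc_cocone x (p : forall t, hom (X t) x) i j (u : @hom disc i j) :
  p j ∘ fmap disc_functor u = p i.
Proof.
have ei : i = j := elimT eqP (valP u); subst j.
by rewrite [fmap _ _]disc_map1 cmpm1.
Qed.

Definition prod_ob (L : countable_limits K) : K := lim_ob (L disc disc_functor).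
Definition prod_pr (L : countable_limits K) (t : T) : hom (prod_ob L) (X t) :=
  lim_pr (L disc disc_functor) t.
Definition prod_lift (L : countable_limits K) (x : K)
    (p : forall t, hom x (X t)) : hom x (prod_ob L) :=
  lim_lift (L disc disc_functor) (disc_cone p).

Definition coprod_ob (L : countable_colimits K) : K :=
  colim_ob (L disc disc_functor).
Definition coprod_in (L : countable_colimits K) (t : T) :
    hom (X t) (coprod_ob L) :=
  colim_in (L disc disc_functor) t.
Definition coprod_desc (L : countable_colimits K) (x : K)
    (p : forall t, hom (X t) x) : hom (coprod_ob L) x :=
  colim_desc (L disc disc_functor) (disc_cocone p).
End Discrete.

Definition ppair_hom (x y : bool) : countType :=
  match x, y with
  | false, true => bool
  | true, false => void
  | _, _ => unit
  end.

Definition ppair_cmp (x y z : bool) :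
    ppair_hom y z -> ppair_hom x y -> ppair_hom x z :=
  match x, y, z with
  | false, false, false => fun _ _ => tt
  | false, false, true => fun v _ => v
  | false, true, true => fun _ u => u
  | true, true, true => fun _ _ => tt
  | false, true, false => fun _ _ => tt
  | true, false, true => fun _ _ => tt
  | true, true, false => fun v _ => v
  | true, false, false => fun _ u => u
  end.

Definition ppair : countable_category.
Proof.
refine (@CountableCategory bool ppair_hom
  (fun x => if x return ppair_hom x x then tt else tt) ppair_cmp _ _ _).
- by case=> [] [] //= [].
- by case=> [] [] //= [].
- by case=> [] [] [] [] //= [] // [].
Defined.

Section Equalizer.
Variables (K : category) (a b : K) (f g : hom a b).

Definition ppair_ob (x : bool) : K := if x then b else a.

Definition ppair_map (x y : bool) :
    ppair_hom x y -> hom (ppair_ob x) (ppair_ob y) :=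
  match x, y with
  | false, true => fun i : bool => if i then g else f
  | true, false => fun v : void => match v with end
  | false, false => fun _ => idm a
  | true, true => fun _ => idm b
  end.

Definition ppair_functor : functor ppair K.
Proof.
refine (@Functor ppair K ppair_ob ppair_map _ _).
- by case.
- by case=> [] [] [] //= v u; rewrite ?cmp1m ?cmpm1 //; case: u; case: v.
Defined.

Definition equalizer_ob (L : countable_limits K) : K :=
  lim_ob (L ppair ppair_functor).
End Equalizer.

Record smc := SMC {
  smc_cat :> category;
  ten : smc_cat -> smc_cat -> smc_cat;
  tenm : forall x x' y y' : smc_cat,
    hom x x' -> hom y y' -> hom (ten x y) (ten x' y');
  tenm1 : forall x y, tenm (idm x) (idm y) = idm (ten x y);
  tenm_cmp : forall x x' x'' y y' y'' (f' : hom x' x'') (f : hom x x')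
    (g' : hom y' y'') (g : hom y y'),
    tenm (f' ∘ f) (g' ∘ g) = tenm f' g' ∘ tenm f g;
  one : smc_cat;
  asc : forall x y z, hom (ten (ten x y) z) (ten x (ten y z));
  asci : forall x y z, hom (ten x (ten y z)) (ten (ten x y) z);
  lun : forall x, hom (ten one x) x;
  luni : forall x, hom x (ten one x);
  run : forall x, hom (ten x one) x;
  runi : forall x, hom x (ten x one);
  brd : forall x y, hom (ten x y) (ten y x);
  ascK : forall x y z, asci x y z ∘ asc x y z = idm _;
  asciK : forall x y z, asc x y z ∘ asci x y z = idm _;
  lunK : forall x, luni x ∘ lun x = idm _;
  luniK : forall x, lun x ∘ luni x = idm _;
  runK : forall x, runi x ∘ run x = idm _;
  runiK : forall x, run x ∘ runi x = idm _;
  brdK : forall x y, brd y x ∘ brd x y = idm _;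
  asc_nat : forall x x' y y' z z' (f : hom x x') (g : hom y y') (h : hom z z'),
    asc x' y' z' ∘ tenm (tenm f g) h = tenm f (tenm g h) ∘ asc x y z;
  lun_nat : forall x x' (f : hom x x'),
    lun x' ∘ tenm (idm one) f = f ∘ lun x;
  run_nat : forall x x' (f : hom x x'),
    run x' ∘ tenm f (idm one) = f ∘ run x;
  brd_nat : forall x x' y y' (f : hom x x') (g : hom y y'),
    brd x' y' ∘ tenm f g = tenm g f ∘ brd x y;
  pentagon : forall x y z w,
    asc x y (ten z w) ∘ asc (ten x y) z w
    = tenm (idm x) (asc y z w) ∘ asc x (ten y z) w ∘ tenm (asc x y z) (idm w);
  triangle : forall x y,
    tenm (idm x) (lun y) ∘ asc x one y = tenm (run x) (idm y);
  hexagon : forall x y z,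
    asc y z x ∘ brd x (ten y z) ∘ asc x y z
    = tenm (idm y) (brd x z) ∘ asc y x z ∘ tenm (brd x y) (idm z)
}.
Arguments ten {s} x y.
Arguments tenm {s x x' y y'} f g.
Arguments one {s}.
Notation "x ⊗ y" := (ten x y) : moncat_scope.
Notation "f ⊗₁ g" := (tenm f g) : moncat_scope.

Record csmc := CSMC {
  csmc_smc :> smc;
  ihom : csmc_smc -> csmc_smc -> csmc_smc;
  ev : forall x y, hom (ihom x y ⊗ x) y;
  curry : forall z x y, hom (z ⊗ x) y -> hom z (ihom x y);
  curryK : forall z x y (f : hom (z ⊗ x) y),
    ev x y ∘ (curry f ⊗₁ idm x) = f;
  curry_uniq : forall z x y (g : hom z (ihom x y)),
    curry (ev x y ∘ (g ⊗₁ idm x)) = g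
}.
Arguments ihom {c} x y.
Arguments ev {c} x y.
Arguments curry {c z x y} f.

Definition uncurry (C : csmc) (z x y : C) (g : hom z (ihom x y)) :
    hom (z ⊗ x) y :=
  ev x y ∘ (g ⊗₁ idm x).

Definition interchange (C : smc) (a b c d : C) :
    hom ((a ⊗ b) ⊗ (c ⊗ d)) ((a ⊗ c) ⊗ (b ⊗ d)) :=
  asci a c (b ⊗ d)
  ∘ (idm a ⊗₁ (asc c b d ∘ (brd b c ⊗₁ idm d) ∘ asci b c d))
  ∘ asc a b (c ⊗ d).

(** The data of a [C]-category with objects [X]; the axioms are [ecat_laws]. *)
Record edata (C : smc) (X : Type) := EData {
  ehom : X -> X -> C;
  eid : forall x, hom one (ehom x x);
  ecmp : forall x y z, hom (ehom y z ⊗ ehom x y) (ehom x z)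
}.
Arguments ehom {C X} e x y.
Arguments eid {C X} e x.
Arguments ecmp {C X} e x y z.

Record ecat_laws (C : smc) (X : Type) (E : edata C X) : Prop := ECatLaws {
  ecmp1m : forall x y,
    ecmp E x y y ∘ (eid E y ⊗₁ idm (ehom E x y)) = lun (ehom E x y);
  ecmpm1 : forall x y,
    ecmp E x x y ∘ (idm (ehom E x y) ⊗₁ eid E x) = run (ehom E x y);
  ecmpA : forall x y z w,
    ecmp E x z w ∘ (idm (ehom E z w) ⊗₁ ecmp E x y z) ∘ asc _ _ _
    = ecmp E x y w ∘ (ecmp E y z w ⊗₁ idm (ehom E x y))
}.

Record efunctor (C : smc) (X Y : Type) (E : edata C X) (G : edata C Y) :=
  EFunctor {
    ef_ob :> X -> Y;
    ef_hom : forall x y, hom (ehom E x y) (ehom G (ef_ob x) (ef_ob y));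
    ef_id : forall x, ef_hom x x ∘ eid E x = eid G (ef_ob x);
    ef_cmp : forall x y z,
      ef_hom x z ∘ ecmp E x y z
      = ecmp G (ef_ob x) (ef_ob y) (ef_ob z) ∘ (ef_hom y z ⊗₁ ef_hom x y)
  }.

Definition eop (C : smc) (X : Type) (E : edata C X) : edata C X :=
  {| ehom := fun x y => ehom E y x;
     eid := eid E;
     ecmp := fun x y z => ecmp E z y x ∘ brd (ehom E z y) (ehom E y x) |}.

Definition eself (C : csmc) : edata C C :=
  {| ehom := fun x y => ihom x y;
     eid := fun x => curry (lun x);
     ecmp := fun x y z =>
       curry (ev y z ∘ (idm (ihom y z) ⊗₁ ev x y)
              ∘ asc (ihom y z) (ihom x y) x) |}.

(** A [C]-enrichment of an ordinary category [K]: a [C]-category with the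
    objects of [K] whose underlying category is [K], that is, morphisms
    [x -> y] of [K] are the points [one -> ehom x y]. *)
Record enrichment (C : smc) (K : category) := Enrichment {
  en_data :> edata C K;
  en_laws : ecat_laws en_data;
  name : forall x y : K, hom x y -> hom one (ehom en_data x y);
  point : forall x y : K, hom one (ehom en_data x y) -> hom x y;
  nameK : forall x y (f : hom x y), point (name f) = f;
  pointK : forall x y (p : hom one (ehom en_data x y)), name (point p) = p;
  name1 : forall x, name (idm x) = eid en_data x;
  name_cmp : forall x y z (g : hom y z) (f : hom x y),
    name (g ∘ f) = ecmp en_data x y z ∘ (name g ⊗₁ name f) ∘ luni one
}.

Section Enriched.
Variables (C : csmc) (K : category) (E : enrichment C K).
Implicit Types (c : C) (x y z : K).

Definition epost x y z (g : hom y z) : hom (ehom E x y) (ehom E x z) :=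
  ecmp E x y z ∘ (name E g ⊗₁ idm (ehom E x y)) ∘ luni (ehom E x y).

Definition epre x y z (f : hom x y) : hom (ehom E y z) (ehom E x z) :=
  ecmp E x y z ∘ (idm (ehom E y z) ⊗₁ name E f) ∘ runi (ehom E y z).

(** The comparison morphisms for a candidate tensor [t] of [c] and [x], resp.
    a candidate cotensor [t] of [c] and [y]. *)
Definition tensor_cmp c x t (eta : hom c (ehom E x t)) y :
    hom (ehom E t y) (ihom c (ehom E x y)) :=
  curry (ecmp E x t y ∘ (idm (ehom E t y) ⊗₁ eta)).

Definition cotensor_cmp c y t (eps : hom c (ehom E t y)) x :
    hom (ehom E x t) (ihom c (ehom E x y)) :=
  curry (ecmp E x t y ∘ (eps ⊗₁ idm (ehom E x t)) ∘ brd (ehom E x t) c).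
End Enriched.

Definition mutually_inverse (K : category) (x y : K) (f : hom x y)
    (g : hom y x) : Prop :=
  g ∘ f = idm x /\ f ∘ g = idm y.

Record tensors (C : csmc) (K : category) (E : enrichment C K) := Tensors {
  act : C -> K -> K;
  act_eta : forall c x, hom c (ehom E x (act c x));
  act_inv : forall c x y, hom (ihom c (ehom E x y)) (ehom E (act c x) y);
  act_invP : forall c x y,
    mutually_inverse (tensor_cmp (act_eta c x) y) (act_inv c x y)
}.

Record cotensors (C : csmc) (K : category) (E : enrichment C K) := Cotensors {
  pow : C -> K -> K;
  pow_eps : forall c y, hom c (ehom E (pow c y) y);
  pow_inv : forall c x y, hom (ihom c (ehom E x y)) (ehom E x (pow c y));
  pow_invP : forall c x y,
    mutually_inverse (cotensor_cmp (pow_eps c y) x) (pow_inv c x y)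
}.

(** The symmetric monoidal structure of [K] is [C]-enriched: the tensor product
    is a [C]-functor extending the ordinary one and the structure isomorphisms
    are [C]-natural. *)
Record enriched_monoidal (C : csmc) (K : smc) (E : enrichment C K) := EMonoidal {
  eten : forall x x' y y' : K,
    hom (ehom E x x' ⊗ ehom E y y') (ehom E (x ⊗ y) (x' ⊗ y'));
  eten_name : forall (x x' y y' : K) (f : hom x x') (g : hom y y'),
    name E (f ⊗₁ g) = eten x x' y y' ∘ (name E f ⊗₁ name E g) ∘ luni one;
  eten_id : forall x y : K,
    eten x x y y ∘ (eid E x ⊗₁ eid E y) = eid E (x ⊗ y) ∘ lun one;
  eten_cmp : forall x x' x'' y y' y'' : K,
    eten x x'' y y'' ∘ (ecmp E x x' x'' ⊗₁ ecmp E y y' y'')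
    = ecmp E (x ⊗ y) (x' ⊗ y') (x'' ⊗ y'')
      ∘ (eten x' x'' y' y'' ⊗₁ eten x x' y y') ∘ interchange _ _ _ _;
  easc_nat : forall x x' y y' z z' : K,
    epost E _ (asc x' y' z')
      ∘ eten (x ⊗ y) (x' ⊗ y') z z' ∘ (eten x x' y y' ⊗₁ idm (ehom E z z'))
    = epre E _ (asc x y z)
      ∘ eten x x' (y ⊗ z) (y' ⊗ z') ∘ (idm (ehom E x x') ⊗₁ eten y y' z z')
      ∘ asc _ _ _;
  elun_nat : forall x x' : K,
    epost E _ (lun x') ∘ eten one one x x'
      ∘ (eid E one ⊗₁ idm (ehom E x x')) ∘ luni (ehom E x x')
    = epre E _ (lun x);
  erun_nat : forall x x' : K,
    epost E _ (run x') ∘ eten x x' one one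
      ∘ (idm (ehom E x x') ⊗₁ eid E one) ∘ runi (ehom E x x')
    = epre E _ (run x);
  ebrd_nat : forall x x' y y' : K,
    epost E _ (brd x' y') ∘ eten x x' y y'
    = epre E _ (brd x y) ∘ eten y y' x x' ∘ brd _ _
}.

Definition euncurry (C : csmc) (K : csmc) (E : enrichment C K)
    (em : enriched_monoidal E) (z x y : K) :
    hom (ehom E z (ihom x y)) (ehom E (z ⊗ x) y) :=
  epost E _ (ev x y) ∘ eten em z (ihom x y) x x
  ∘ (idm (ehom E z (ihom x y)) ⊗₁ eid E x) ∘ runi _.

Record csm_ccat (C : csmc) := CSMCCat {
  cd_csmc :> csmc;
  cd_enr : enrichment C cd_csmc;
  cd_mon : enriched_monoidal cd_enr;
  cd_ecurry : forall z x y : cd_csmc,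
    hom (ehom cd_enr (z ⊗ x) y) (ehom cd_enr z (ihom x y));
  cd_ecurryP : forall z x y : cd_csmc,
    mutually_inverse (euncurry cd_mon z x y) (cd_ecurry z x y);
  cd_tensors : tensors cd_enr;
  cd_cotensors : cotensors cd_enr
}.

Section CCatOps.
Variables (C : csmc) (D : csm_ccat C).
Implicit Types (c : C) (x y z : D).

Definition Map x y : C := ehom (cd_enr D) x y.

Definition tensor c x : D := act (cd_tensors D) c x.
Definition cotensor c y : D := pow (cd_cotensors D) c y.
Local Notation "c ⊳ x" := (tensor c x) : moncat_scope.

Definition tensor_eta c x : hom c (Map x (c ⊳ x)) := act_eta (cd_tensors D) c x.

(** The morphism [c ⊳ x -> y] corresponding to [u : c -> Map x y]. *)
Definition tensor_adj c x y (u : hom c (Map x y)) : hom (c ⊳ x) y :=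
  point (act_inv (cd_tensors D) c x y ∘ curry (u ∘ lun c)).

Definition tensor_map c c' x x' (h : hom c c') (f : hom x x') :
    hom (c ⊳ x) (c' ⊳ x') :=
  tensor_adj (epre (cd_enr D) _ f ∘ tensor_eta c' x' ∘ h).

Definition tensor_unit x : hom (one ⊳ x) x := tensor_adj (eid (cd_enr D) x).

Definition tensor_asc c c' x : hom ((c ⊗ c') ⊳ x) (c ⊳ (c' ⊳ x)) :=
  tensor_adj (ecmp (cd_enr D) x (c' ⊳ x) (c ⊳ (c' ⊳ x))
              ∘ (tensor_eta c (c' ⊳ x) ⊗₁ tensor_eta c' x)).

Definition tensor_l c x y : hom (c ⊳ (x ⊗ y)) ((c ⊳ x) ⊗ y) :=
  tensor_adj (eten (cd_mon D) x (c ⊳ x) y y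
              ∘ (tensor_eta c x ⊗₁ eid (cd_enr D) y) ∘ runi c).

Definition tensor_li c x y : hom ((c ⊳ x) ⊗ y) (c ⊳ (x ⊗ y)) :=
  uncurry (tensor_adj (cd_ecurry x y (c ⊳ (x ⊗ y)) ∘ tensor_eta c (x ⊗ y))).

Definition tensor_r c x y : hom (c ⊳ (x ⊗ y)) (x ⊗ (c ⊳ y)) :=
  brd (c ⊳ y) x ∘ tensor_l c y x ∘ tensor_map (idm c) (brd x y).

Definition tensor_distr c c' x y :
    hom ((c ⊗ c') ⊳ (x ⊗ y)) ((c ⊳ x) ⊗ (c' ⊳ y)) :=
  tensor_l c x (c' ⊳ y) ∘ tensor_map (idm c) (tensor_r c' x y)
  ∘ tensor_asc c c' (x ⊗ y).

Definition cotensor_ev c y : hom (c ⊳ cotensor c y) y :=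
  tensor_adj (pow_eps (cd_cotensors D) c y).

(** The morphism [x -> cotensor c y] corresponding to [f : c ⊳ x -> y]. *)
Definition cotensor_adj c x y (f : hom (c ⊳ x) y) : hom x (cotensor c y) :=
  point (pow_inv (cd_cotensors D) c x y
         ∘ tensor_cmp (tensor_eta c x) y ∘ name (cd_enr D) f).

Definition cotensor_map c c' y y' (h : hom c c') (g : hom y y') :
    hom (cotensor c' y) (cotensor c y') :=
  cotensor_adj (g ∘ cotensor_ev c' y ∘ tensor_map h (idm (cotensor c' y))).
End CCatOps.

Notation "c ⊳ x" := (tensor c x) : moncat_scope.
Notation "h ⊳₁ f" := (tensor_map h f) : moncat_scope.

(** Operads are given on the skeleton of finite linearly ordered sets: the
    linear order with [n] elements is [n : nat], and an order-preserving map
    [S -> T] is the list, of length [T], of the cardinalities of its fibres,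
    whose sum is [S].  For such a list [ks], [ptens P ks] is [P[f]]. *)
Section OperadTools.
Variables (C : smc) (P : nat -> C).

Fixpoint ptens (ks : seq nat) : C :=
  if ks is k :: ks' then P k ⊗ ptens ks' else one.

Definition pcast m n (e : m = n) : hom (P m) (P n) :=
  match e with erefl => idm (P m) end.

Definition ptens_cast ks ks' (e : ks = ks') : hom (ptens ks) (ptens ks') :=
  match e with erefl => idm (ptens ks) end.

Fixpoint ptens_split ks ks' :
    hom (ptens (ks ++ ks')) (ptens ks ⊗ ptens ks') :=
  if ks is k :: ks1
  then asci (P k) (ptens ks1) (ptens ks') ∘ (idm (P k) ⊗₁ ptens_split ks1 ks')
  else luni (ptens ks').

Fixpoint ptens_merge ks ks' :
    hom (ptens ks ⊗ ptens ks') (ptens (ks ++ ks')) :=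
  if ks is k :: ks1
  then (idm (P k) ⊗₁ ptens_merge ks1 ks') ∘ asc (P k) (ptens ks1) (ptens ks')
  else lun (ptens ks').

Definition ptens_rot r ks : hom (ptens ks) (ptens (rot r ks)) :=
  ptens_merge (drop r ks) (take r ks)
  ∘ brd (ptens (take r ks)) (ptens (drop r ks))
  ∘ ptens_split (take r ks) (drop r ks)
  ∘ ptens_cast (esym (cat_take_drop r ks)).

Variable u : hom one (P 1).

Fixpoint ptens_units n : hom one (ptens (nseq n 1)) :=
  if n is n'.+1 then (u ⊗₁ ptens_units n') ∘ luni one else idm one.

Variable mu : forall ks, hom (P (size ks) ⊗ ptens ks) (P (sumn ks)).

(** [P[g] ⊗ P[f] -> P[g f]], applying the structure maps over each point of
    the target of [g]; [kss] lists the fibre sizes of [f] grouped according to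
    the fibres of [g]. *)
Fixpoint ptens_mu (kss : seq (seq nat)) :
    hom (ptens (shape kss) ⊗ ptens (flatten kss)) (ptens (map sumn kss)) :=
  if kss is ks :: kss'
  then (mu ks ⊗₁ ptens_mu kss')
       ∘ interchange (P (size ks)) (ptens (shape kss'))
                     (ptens ks) (ptens (flatten kss'))
       ∘ (idm _ ⊗₁ ptens_split ks (flatten kss'))
  else lun one.
End OperadTools.

Record operad (C : smc) := Operad {
  op_ob :> nat -> C;
  op_one : hom one (op_ob 1);
  op_mu : forall ks, hom (op_ob (size ks) ⊗ ptens op_ob ks) (op_ob (sumn ks));
  op_unitl : forall n,
    pcast op_ob (addn0 n) ∘ op_mu [:: n] ∘ (op_one ⊗₁ runi (op_ob n))
    = lun (op_ob n);
  op_unitr : forall n,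
    pcast op_ob (etrans (sumn_nseq 1 n) (mul1n n)) ∘ op_mu (nseq n 1)
      ∘ (pcast op_ob (esym (size_nseq n 1)) ⊗₁ ptens_units op_one n)
    = run (op_ob n);
  op_assoc : forall kss : seq (seq nat),
    op_mu (flatten kss)
      ∘ ((pcast op_ob (esym (size_flatten kss)) ∘ op_mu (shape kss)
          ∘ (pcast op_ob (esym (size_map size kss))
             ⊗₁ idm (ptens op_ob (shape kss))))
         ⊗₁ idm (ptens op_ob (flatten kss)))
      ∘ asci _ _ _
    = pcast op_ob (esym (sumn_flatten kss)) ∘ op_mu (map sumn kss)
      ∘ (pcast op_ob (esym (size_map sumn kss)) ⊗₁ ptens_mu op_mu kss)
}.

Section Tpow.
Variables (K : smc) (A : K).

Fixpoint tpow n : K := if n is n'.+1 then A ⊗ tpow n' else one.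

Definition tpow_cast m n (e : m = n) : hom (tpow m) (tpow n) :=
  match e with erefl => idm (tpow m) end.

Fixpoint tpow_split m n : hom (tpow (m + n)) (tpow m ⊗ tpow n) :=
  match m return hom (tpow (m + n)) (tpow m ⊗ tpow n) with
  | 0 => luni (tpow n)
  | m'.+1 => asci A (tpow m') (tpow n) ∘ (idm A ⊗₁ tpow_split m' n)
  end.
End Tpow.

(** [P[f] ⊗ A^S -> A^T], given by the action maps over each point of [T]. *)
Fixpoint tpow_act (C : csmc) (D : csm_ccat C) (P : nat -> C) (A : D)
    (al : forall n, hom (P n ⊳ tpow A n) A) (ks : seq nat) :
    hom (ptens P ks ⊳ tpow A (sumn ks)) (tpow A (size ks)) :=
  if ks is k :: ks'
  then (al k ⊗₁ tpow_act al ks')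
       ∘ tensor_distr (P k) (ptens P ks') (tpow A k) (tpow A (sumn ks'))
       ∘ (idm _ ⊳₁ tpow_split A k (sumn ks'))
  else tensor_unit (D := D) one.

Record algebra (C : csmc) (D : csm_ccat C) (P : operad C) := Algebra {
  alg_ob :> D;
  alg_act : forall n, hom (P n ⊳ tpow alg_ob n) alg_ob;
  alg_unit :
    alg_act 1 ∘ (op_one P ⊳₁ runi alg_ob) = tensor_unit alg_ob;
  alg_assoc : forall ks,
    alg_act (sumn ks) ∘ (op_mu P ks ⊳₁ idm _)
    = alg_act (size ks) ∘ (idm (P (size ks)) ⊳₁ tpow_act alg_act ks)
      ∘ tensor_asc _ _ _
}.

Lemma size_insert (ks1 ks2 : seq nat) k :
  size ks1 + (size ks2).+1 = size (ks1 ++ k :: ks2).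
Proof. by rewrite size_cat. Qed.

Lemma sumn_insert (ks1 ks2 : seq nat) a b :
  sumn (ks1 ++ (a + b.+1) :: ks2) = (sumn ks1 + a) + (b + sumn ks2).+1.
Proof. by rewrite sumn_cat /= -!addnA addSn. Qed.

(** [(x1 x) (m (y y2)) = x1 ((x (m y)) y2)], keeping the order of the factors *)
Definition regroup (K : smc) (x1 x m y y2 : K) :
    hom ((x1 ⊗ x) ⊗ (m ⊗ (y ⊗ y2))) (x1 ⊗ ((x ⊗ (m ⊗ y)) ⊗ y2)) :=
  (idm x1 ⊗₁ (asci x (m ⊗ y) y2 ∘ (idm x ⊗₁ asci m y y2)))
  ∘ asc x1 x (m ⊗ (y ⊗ y2)).

(** [bim_act a b] is the structure map with [n = a + 1 + b] and [i = a + 1]. *)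
Record bimodule (C : csmc) (D : csm_ccat C) (P : operad C) (A : algebra D P) :=
  Bimodule {
    bim_ob :> D;
    bim_act : forall a b,
      hom (P (a + b.+1) ⊳ (tpow A a ⊗ (bim_ob ⊗ tpow A b))) bim_ob;
    bim_unit :
      bim_act 0 0 ∘ (op_one P ⊳₁ (luni _ ∘ runi bim_ob)) = tensor_unit bim_ob;
    (** [bim_ob] is the factor number [a + 1] of the block of length
        [a + 1 + b] lying between the blocks [ks1] and [ks2]. *)
    bim_assoc : forall ks1 a b ks2,
      bim_act (sumn ks1 + a) (b + sumn ks2)
        ∘ ((pcast P (sumn_insert ks1 ks2 a b) ∘ op_mu P (ks1 ++ (a + b.+1) :: ks2)
            ∘ (pcast P (size_insert ks1 ks2 (a + b.+1))
               ⊗₁ ptens_merge P ks1 ((a + b.+1) :: ks2)))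
           ⊳₁ idm _)
      = bim_act (size ks1) (size ks2)
        ∘ (idm _ ⊳₁
            ((tpow_act (alg_act A) ks1
              ⊗₁ ((bim_act a b ⊗₁ tpow_act (alg_act A) ks2)
                  ∘ tensor_distr _ _ _ _))
             ∘ tensor_distr _ _ _ _
             ∘ (idm _ ⊳₁
                 (regroup _ _ _ _ _
                  ∘ (tpow_split A (sumn ks1) a
                     ⊗₁ (idm bim_ob ⊗₁ tpow_split A b (sumn ks2)))))))
        ∘ tensor_asc _ _ _
  }.

(** The object [n] is the set ['I_n.+1] with its standard cyclic order and the
    basepoint [ord0].  The list [fib t] enumerates the fibre over [t] (each of
    its elements exactly once) in its linear order.  Two lists present the same
    cyclic order when they differ by a rotation. *)
Definition is_cycmap m n (f : {ffun 'I_m.+1 -> 'I_n.+1})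
    (fib : {ffun 'I_n.+1 -> seq 'I_m.+1}) : bool :=
  [&& f ord0 == ord0,
      [forall t, [forall s, count_mem s (fib t) == (f s == t)]]
    & [exists r : 'I_m.+1,
        flatten [seq fib t | t <- enum 'I_n.+1] == rot r (enum 'I_m.+1)]].

Record cycmap m n := CycMap {
  cycdata : {ffun 'I_m.+1 -> 'I_n.+1} * {ffun 'I_n.+1 -> seq 'I_m.+1};
  cycmapP : is_cycmap cycdata.1 cycdata.2
}.

HB.instance Definition _ m n := [isSub for @cycdata m n].
HB.instance Definition _ m n := [Countable of cycmap m n by <:].

Definition cycfun m n (f : cycmap m n) : 'I_m.+1 -> 'I_n.+1 := (cycdata f).1.
Definition fib m n (f : cycmap m n) : 'I_n.+1 -> seq 'I_m.+1 := (cycdata f).2.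

Section CycMapTheory.
Variables (m n : nat) (f : cycmap m n).

Lemma cycfun0 : cycfun f ord0 = ord0.
Proof. by case/and3P: (cycmapP f) => /eqP. Qed.

Lemma count_fib s t : count_mem s (fib f t) = (cycfun f s == t).
Proof. by case/and3P: (cycmapP f) => _ /forallP/(_ t)/forallP/(_ s)/eqP. Qed.

Lemma cycrot_ex : exists r : 'I_m.+1,
  flatten [seq fib f t | t <- enum 'I_n.+1] == rot r (enum 'I_m.+1).
Proof. by case/and3P: (cycmapP f) => _ _ /existsP. Qed.

Definition cycrot : 'I_m.+1 := xchoose cycrot_ex.

Lemma cycrotP :
  flatten [seq fib f t | t <- enum 'I_n.+1] = rot cycrot (enum 'I_m.+1).
Proof. exact/eqP/(xchooseP cycrot_ex). Qed.

Lemma mem_fib s t : (s \in fib f t) = (cycfun f s == t).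
Proof. by rewrite -has_pred1 has_count count_fib; case: eqP. Qed.

(** The elements of the fibre of [ord0] less, resp. greater, than [ord0]. *)
Definition fib0_lt : seq 'I_m.+1 := take (index ord0 (fib f ord0)) (fib f ord0).
Definition fib0_gt : seq 'I_m.+1 :=
  drop (index ord0 (fib f ord0)).+1 (fib f ord0).

Lemma fib0E : fib f ord0 = fib0_lt ++ ord0 :: fib0_gt.
Proof.
have i0 : ord0 \in fib f ord0 by rewrite mem_fib cycfun0.
rewrite -{1}(cat_take_drop (index ord0 (fib f ord0)) (fib f ord0)).
by rewrite (drop_nth ord0) ?index_mem // nth_index.
Qed.

(** Cutting at [ord0]: the order of the non-zero elements. *)
Lemma cycmap_cut :
  behead (enum 'I_m.+1)
  = fib0_gt ++ flatten [seq fib f (lift ord0 t) | t <- enum 'I_n] ++ fib0_lt.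
Proof.
set rest := flatten _.
have eF : rot cycrot (enum 'I_m.+1) = fib0_lt ++ (ord0 :: fib0_gt ++ rest).
  by rewrite -cycrotP enum_ordSl /= -map_comp fib0E -catA.
have [r r_lt er] : exists2 r, r <= m &
    rot r (enum 'I_m.+1) = ord0 :: fib0_gt ++ rest ++ fib0_lt.
  have := congr1 (rot (size fib0_lt)) eF.
  rewrite rot_size_cat rot_add_mod ?size_enum_ord; last 2 first.
  - exact: ltnW (ltn_ord _).
  - have := congr1 size eF; rewrite size_rot size_enum_ord size_cat => sz.
    exact: leq_trans (leq_addr _ _) (eq_leq (esym sz)).
  rewrite !cat_cons -!catA => er.
  set r := (if _ then _ else _) in er.
  have [r_le|r_gt] := leqP r m; first by exists r.
  by exists 0; rewrite // rot0 -er rot_oversize ?size_enum_ord.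
have r0 : r = 0.
  have := congr1 (fun s => nth ord0 s 0) er.
  rewrite /rot nth_cat size_drop size_enum_ord subn_gt0 ltnS r_lt nth_drop addn0.
  by move/(congr1 val); rewrite /= nth_enum_ord.
by move: er; rewrite r0 rot0 => ->.
Qed.

Definition fsizes : seq nat := [seq size (fib f t) | t <- enum 'I_n.+1].
Definition fsizes' : seq nat := [seq size (fib f (lift ord0 t)) | t <- enum 'I_n].

Lemma fsizesE : fsizes = size (fib f ord0) :: fsizes'.
Proof. by rewrite /fsizes enum_ordSl /= -map_comp. Qed.

Lemma size_fsizes' : size fsizes' = n.
Proof. by rewrite size_map size_enum_ord. Qed.

Lemma size_fib0 : size (fib f ord0) = size fib0_gt + (size fib0_lt).+1.
Proof. by rewrite {1}fib0E size_cat addnC addSnnS. Qed.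

Lemma size_cut : m = size fib0_gt + (sumn fsizes' + size fib0_lt).
Proof.
have := congr1 size cycmap_cut.
rewrite size_behead size_enum_ord !size_cat size_flatten /shape -map_comp.
by [].
Qed.
End CycMapTheory.

Lemma fib_id_subproof n :
  is_cycmap [ffun s : 'I_n.+1 => s] [ffun t : 'I_n.+1 => [:: t]].
Proof.
apply/and3P; split; first by rewrite ffunE.
- by apply/forallP => t; apply/forallP => s; rewrite !ffunE /= addn0 [t == s]eq_sym.
- apply/existsP; exists ord0; rewrite rot0.
  under eq_map => t do rewrite ffunE.
  by rewrite flatten_map1 map_id.
Qed.

Definition cycid n : cycmap n n := @CycMap n n (_, _) (fib_id_subproof n).

Lemma flatten_rot (T : Type) r (ss : seq (seq T)) :
  exists q, flatten (rot r ss) = rot q (flatten ss).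
Proof.
exists (size (flatten (take r ss))).
by rewrite -{3}(cat_take_drop r ss) flatten_cat rot_size_cat /rot flatten_cat.
Qed.

Lemma flatten_bind (S T U : Type) (F : S -> seq T) (G : U -> seq S) s :
  flatten [seq flatten [seq F t | t <- G u] | u <- s]
  = flatten [seq F t | t <- flatten [seq G u | u <- s]].
Proof. by elim: s => //= u s ->; rewrite map_cat flatten_cat. Qed.

Section CycComp.
Variables (m n p : nat) (g : cycmap n p) (f : cycmap m n).

Definition cyccomp_fun : {ffun 'I_m.+1 -> 'I_p.+1} :=
  [ffun s => cycfun g (cycfun f s)].
Definition cyccomp_fib : {ffun 'I_p.+1 -> seq 'I_m.+1} :=
  [ffun u => flatten [seq fib f t | t <- fib g u]].

Lemma cyccomp_subproof : is_cycmap cyccomp_fun cyccomp_fib.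
Proof.
apply/and3P; split; first by rewrite ffunE !cycfun0.
- apply/forallP => u; apply/forallP => s; rewrite !ffunE -(count_fib g).
  rewrite count_flatten -map_comp -sumn_count; apply/eqP; congr sumn.
  by apply: eq_map => t /=; rewrite count_fib eq_sym.
- have -> : flatten [seq cyccomp_fib u | u <- enum 'I_p.+1]
            = flatten (rot (cycrot g) [seq fib f t | t <- enum 'I_n.+1]).
    under eq_map => u do rewrite ffunE.
    by rewrite flatten_bind -/(fib g) cycrotP map_rot.
  have [q ->] := flatten_rot (cycrot g) [seq fib f t | t <- enum 'I_n.+1].
  have [q_ge|q_lt] := leqP m.+1 q.
    apply/existsP; exists (cycrot f).
    by rewrite rot_oversize cycrotP // size_rot size_enum_ord.
  rewrite cycrotP rot_add_mod ?size_enum_ord; last 2 first.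
  - exact: ltnW (ltn_ord _).
  - exact: ltnW.
  set r := if _ then _ else _.
  have [r_lt|r_ge] := ltnP r m.+1.
    by apply/existsP; exists (Ordinal r_lt).
  by apply/existsP; exists ord0; rewrite rot0 rot_oversize ?size_enum_ord.
Qed.

Definition cyccomp : cycmap m p := @CycMap m p (_, _) cyccomp_subproof.

Definition fgroups : seq (seq nat) :=
  [seq [seq size (fib f t) | t <- fib g u] | u <- enum 'I_p.+1].

Lemma shape_fgroups : fsizes g = shape fgroups.
Proof.
by rewrite /shape -map_comp; apply: eq_map => u /=; rewrite size_map.
Qed.

Lemma flatten_fgroups : rot (cycrot g) (fsizes f) = flatten fgroups.
Proof. by rewrite /fsizes -map_rot -cycrotP map_flatten -map_comp. Qed.

Lemma sumn_fgroups : map sumn fgroups = fsizes cyccomp.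
Proof.
rewrite -map_comp; apply: eq_map => u /=.
by rewrite /fib /= ffunE size_flatten /shape -map_comp.
Qed.
End CycComp.

Lemma fsizes_id n : nseq n.+1 1 = fsizes (cycid n).
Proof.
rewrite -[in LHS](size_enum_ord n.+1) /fsizes.
by elim: (enum _) => //= t s ->; rewrite /fib ffunE.
Qed.

Section DeltaCP.
Variables (C : csmc) (colC : countable_colimits C) (P : operad C).

Definition Pmap m n (f : cycmap m n) : C := ptens P (fsizes f).

Definition Pmap_comp m n p (g : cycmap n p) (f : cycmap m n) :
    hom (Pmap g ⊗ Pmap f) (Pmap (cyccomp g f)) :=
  ptens_cast P (sumn_fgroups g f) ∘ ptens_mu (op_mu P) (fgroups g f)
  ∘ (ptens_cast P (shape_fgroups g f)
     ⊗₁ (ptens_cast P (flatten_fgroups g f) ∘ ptens_rot P (cycrot g) (fsizes f))).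

Definition DCP_hom (m n : nat) : C := coprod_ob (@Pmap m n) colC.
Definition DCP_in m n (f : cycmap m n) : hom (Pmap f) (DCP_hom m n) :=
  coprod_in (@Pmap m n) colC f.

(** Morphisms out of [DCP_hom m n ⊗ x] are families of morphisms out of
    [Pmap f ⊗ x], since [- ⊗ x] is a left adjoint. *)
Definition DCP_desc m n (x y : C)
    (h : forall f : cycmap m n, hom (Pmap f ⊗ x) y) : hom (DCP_hom m n ⊗ x) y :=
  uncurry (coprod_desc colC (fun f => curry (h f))).

Definition DCP : edata C nat :=
  {| ehom := DCP_hom;
     eid := fun n =>
       DCP_in (cycid n) ∘ ptens_cast P (fsizes_id n) ∘ ptens_units (op_one P) n.+1;
     ecmp := fun m n p =>
       DCP_desc (fun g : cycmap n p =>
         DCP_desc (fun f : cycmap m n =>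
           DCP_in (cyccomp g f) ∘ Pmap_comp g f ∘ brd (Pmap f) (Pmap g))
         ∘ brd (Pmap g) (DCP_hom m n)) |}.

(** [C]-functors only refer to the data of their source, so the axioms of a
    [C]-category are not needed for [DCP] here. *)
Definition DCP_presheaf := efunctor (eop DCP) (eself C).

Definition presheaf_act (R : DCP_presheaf) m n (f : cycmap m n) :
    hom (R n ⊗ Pmap f) (R m) :=
  uncurry (ef_hom R n m ∘ DCP_in f) ∘ brd (R n) (Pmap f).
End DeltaCP.
Arguments presheaf_act {C colC P} R {m n} f.

Section Cotraces.
Variables (C : csmc) (colC : countable_colimits C) (D : csm_ccat C).
Variables (P : operad C) (A : algebra D P) (M : bimodule A).

(** The set [S - {0}] has [m] elements, so [A^(S - {0})] is [tpow A m]; by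
    [cycmap_cut] its factors are, in order, those of [fib0_gt f], of the fibres
    over the non-zero points, and of [fib0_lt f]. *)
Definition cut_split m n (f : cycmap m n) :
    hom (tpow A m) (tpow A (size (fib0_gt f))
                    ⊗ (tpow A (sumn (fsizes' f)) ⊗ tpow A (size (fib0_lt f)))) :=
  (idm _ ⊗₁ tpow_split A (sumn (fsizes' f)) (size (fib0_lt f)))
  ∘ tpow_split A (size (fib0_gt f)) (sumn (fsizes' f) + size (fib0_lt f))
  ∘ tpow_cast A (size_cut f).

Definition insert_factor (X a b c : D) :
    hom (X ⊗ (a ⊗ (b ⊗ c))) (a ⊗ ((X ⊗ b) ⊗ c)) :=
  (idm a ⊗₁ asci X b c) ∘ asc a X (b ⊗ c) ∘ (brd X a ⊗₁ idm (b ⊗ c))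
  ∘ asci X a (b ⊗ c).

Definition act_nonzero m n (f : cycmap m n) :
    hom (ptens P (fsizes' f) ⊳ tpow A (sumn (fsizes' f))) (tpow A n) :=
  tpow_cast A (size_fsizes' f) ∘ tpow_act (alg_act A) (fsizes' f).

(** The map [φ_f].  Over [ord0] it uses the bimodule structure map with
    [i - 1 = #L_>] and [n - i = #L_<]: as the factors of [A^(S - {0})] keep
    their order, those of [L_>] come before [M] and those of [L_<] after it. *)
Definition extend m n (f : cycmap m n) (X : D) (phi : hom (X ⊗ tpow A n) M) :
    hom ((Pmap P f ⊳ X) ⊗ tpow A m) M :=
  let Q := ptens P (fsizes' f) in
  let k := sumn (fsizes' f) in
  let a := size (fib0_gt f) in
  let b := size (fib0_lt f) in
  let inner : hom (Q ⊳ (X ⊗ tpow A m)) (tpow A a ⊗ (M ⊗ tpow A b)) :=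
    (idm (tpow A a) ⊗₁
      (((phi ∘ (idm X ⊗₁ act_nonzero f) ∘ tensor_r Q X (tpow A k))
        ⊗₁ idm (tpow A b))
       ∘ tensor_l Q (X ⊗ tpow A k) (tpow A b)))
    ∘ tensor_r Q (tpow A a) ((X ⊗ tpow A k) ⊗ tpow A b)
    ∘ (idm Q ⊳₁ (insert_factor X _ _ _ ∘ (idm X ⊗₁ cut_split f))) in
  bim_act M a b
  ∘ (pcast P (size_fib0 f) ⊳₁ inner)
  ∘ tensor_asc (P (size (fib f ord0))) Q (X ⊗ tpow A m)
  ∘ (ptens_cast P (fsizesE f) ⊳₁ idm (X ⊗ tpow A m))
  ∘ tensor_li (Pmap P f) X (tpow A m).

Variable R : DCP_presheaf colC P.

Record cotrace (B : D) := Cotrace {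
  ct_map :> forall n, hom ((R n ⊳ B) ⊗ tpow A n) M;
  ct_compat : forall m n (f : cycmap m n),
    ct_map m ∘ ((presheaf_act R f ⊳₁ idm B) ⊗₁ idm (tpow A m))
    = extend f (ct_map n)
      ∘ ((tensor_asc (Pmap P f) (R n) B ∘ (brd (R n) (Pmap P f) ⊳₁ idm B))
         ⊗₁ idm (tpow A m))
}.

Definition cobar (n : nat) : D := ihom (tpow A n) M.

Definition cobar_act m n (f : cycmap m n) : hom (Pmap P f ⊳ cobar n) (cobar m) :=
  curry (extend f (ev (tpow A n) M)).

Variable limD : countable_limits D.

Definition cobar_src (n : nat) : D := cotensor (R n) (cobar n).

Definition cyc_arrow : countType := {mn : nat * nat & cycmap mn.1 mn.2}.

Definition cobar_tgt (u : cyc_arrow) : D :=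
  cotensor (R (tag u).2 ⊗ Pmap P (tagged u)) (cobar (tag u).1).

Definition restrict_source (u : cyc_arrow) : hom (cobar_src (tag u).1) (cobar_tgt u) :=
  cotensor_map (presheaf_act R (tagged u)) (idm _).

(** [Hom(R(T), F(T)) -> Hom(R(T) ⊗ P[f], P[f] ⊗ F(T)) -> Hom(R(T) ⊗ P[f], F(S))] *)
Definition restrict_target (u : cyc_arrow) : hom (cobar_src (tag u).2) (cobar_tgt u) :=
  let c := R (tag u).2 in
  let y := cobar (tag u).2 in
  let Pf := Pmap P (tagged u) in
  cotensor_map (idm (c ⊗ Pf)) (cobar_act (tagged u))
  ∘ cotensor_adj
      ((idm Pf ⊳₁ cotensor_ev c y) ∘ tensor_asc Pf c (cotensor c y)
       ∘ (brd c Pf ⊳₁ idm (cotensor c y))).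

Definition Hom_DCP_cobar : D :=
  equalizer_ob
    (prod_lift limD (fun u => restrict_source u ∘ prod_pr cobar_src limD (tag u).1)
       : hom (prod_ob cobar_src limD) (prod_ob cobar_tgt limD))
    (prod_lift limD (fun u => restrict_target u ∘ prod_pr cobar_src limD (tag u).2))
    limD.
End Cotraces.

(* Main.v *)
(* A morphism [B -> Hom(R, F)] is a family [B -> Hom(R(S), F(S))] equalizing
   two restrictions; transposing along the cotensor and then along the closed
   structure gives maps [τ_S : (R(S) ⊗ B) ⊗ A^(S - {0}) -> M].  Since
   [φ ↦ φ_f] is natural in [X], and [F(T) ⊗ P[f] -> F(S)] is the transpose of
   [ev_f], the map [(τ_T)_f] is the transpose of the second restriction, so
   the equalizer condition is the cotrace condition.  Naturality of [φ_f]
   reduces to that of the comparison morphisms of the tensor, which is checked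
   on their transposes [c -> Map x y] in the enriching category. *)
From Stdlib Require Import FunctionalExtensionality ProofIrrelevance.
From mathcomp Require Import all_boot.
Require Import Defs.

Set Implicit Arguments.
Unset Strict Implicit.
Unset Printing Implicit Defensive.
Local Open Scope moncat_scope.

(** * Rewriting and cancellation in a category *)

(** Lets an equation between composites be applied inside a right-associated chain. *)
Lemma cmp_assoc_subst (K : category) (x y z : K) (g : hom y z) (f : hom x y)
    (h : hom x z) :
  g ∘ f = h -> forall (w : K) (k : hom w x), g ∘ (f ∘ k) = h ∘ k.
Proof. by move=> <- w k; rewrite cmpA. Qed.

Lemma epi_split (K : category) (a b c : K) (e : hom a b) (s : hom b a) :
  e ∘ s = idm b -> forall f g : hom b c, f ∘ e = g ∘ e -> f = g.
Proof. by move=> es f g /(congr1 (fun h => h ∘ s)); rewrite -!cmpA es !cmpm1. Qed.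

Lemma mono_split (K : category) (a b c : K) (m : hom b c) (r : hom c b) :
  r ∘ m = idm b -> forall f g : hom a b, m ∘ f = m ∘ g -> f = g.
Proof. by move=> rm f g /(congr1 (fun h => r ∘ h)); rewrite !cmpA rm !cmp1m. Qed.

(** * Coherence in a symmetric monoidal category *)

Section Coherence.
Variable C : smc.
Implicit Types x y z w : C.

Lemma tenmM x x' x'' y y' y'' (f' : hom x' x'') (f : hom x x')
    (g' : hom y' y'') (g : hom y y') :
  (f' ⊗₁ g') ∘ (f ⊗₁ g) = (f' ∘ f) ⊗₁ (g' ∘ g).
Proof. by rewrite tenm_cmp. Qed.

Definition tenmMA x x' x'' y y' y'' (f' : hom x' x'') (f : hom x x')
    (g' : hom y' y'') (g : hom y y') := cmp_assoc_subst (tenmM f' f g' g).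

Lemma tenm_cmpl x y z w (g : hom y z) (f : hom x y) :
  (g ∘ f) ⊗₁ idm w = (g ⊗₁ idm w) ∘ (f ⊗₁ idm w).
Proof. by rewrite tenmM cmp1m. Qed.

Lemma tenm_cmpr x y z w (g : hom y z) (f : hom x y) :
  idm w ⊗₁ (g ∘ f) = (idm w ⊗₁ g) ∘ (idm w ⊗₁ f).
Proof. by rewrite tenmM cmp1m. Qed.

(** Conjugating [idm one ⊗₁ f] by the natural isomorphism [lun] recovers [f]. *)
Lemma lun_inj x y (f g : hom x y) :
  idm (one : C) ⊗₁ f = idm one ⊗₁ g -> f = g.
Proof.
move=> e; have := congr1 (fun h => lun y ∘ h ∘ luni x) e.
by rewrite !lun_nat -!cmpA luniK !cmpm1.
Qed.

Lemma run_inj x y (f g : hom x y) :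
  f ⊗₁ idm (one : C) = g ⊗₁ idm one -> f = g.
Proof.
move=> e; have := congr1 (fun h => run y ∘ h ∘ runi x) e.
by rewrite !run_nat -!cmpA runiK !cmpm1.
Qed.

(** Kelly's argument: whiskered by [one] on the left and precomposed with an isomorphism, the claim
    becomes the pentagon for [one], [one], [x], [y] combined with two triangles. *)
Lemma lun_ten x y : lun (x ⊗ y) ∘ asc one x y = lun x ⊗₁ idm y.
Proof.
apply: lun_inj.
have e : (asc one (one ⊗ x) y ∘ (asc one one x ⊗₁ idm y))
    ∘ ((asci one one x ⊗₁ idm y) ∘ asci one (one ⊗ x) y) = idm _.
  by rewrite -!cmpA tenmMA asciK cmp1m tenm1 cmp1m asciK.
apply: (epi_split e).
rewrite -[idm one in LHS](cmp1m (idm one)) tenm_cmp -!cmpA.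
have := pentagon one one x y; rewrite -!cmpA => <-.
rewrite (cmp_assoc_subst (triangle _ _)) (cmp_assoc_subst (esym (asc_nat _ _ _))).
by rewrite -cmpA tenmM triangle cmp1m -tenm1 asc_nat.
Qed.

Lemma run_ten x y : (idm x ⊗₁ run y) ∘ asc x y one = run (x ⊗ y).
Proof.
apply: run_inj; apply: (mono_split (ascK x y one)).
rewrite -triangle -tenm1 (cmp_assoc_subst (asc_nat _ _ _)) -cmpA.
rewrite pentagon !cmpA !tenmM triangle !cmp1m.
rewrite -(cmp1m (idm one)) tenm_cmp !cmpA asc_nat.
by rewrite cmp1m.
Qed.

Lemma lun_one : lun one = run one :> hom (one ⊗ one : C) one.
Proof.
apply: run_inj; rewrite -lun_ten -triangle; congr (_ ∘ _).
(* Naturality of [lun] at [lun one] gives [lun (one ⊗ one) = idm one ⊗₁ lun one] once the invertible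
   [lun one] is cancelled. *)
by apply: (mono_split (lunK (one : C))); rewrite lun_nat.
Qed.

Lemma luni_one : luni one = runi one :> hom (one : C) (one ⊗ one).
Proof. by apply: (mono_split (lunK (one : C))); rewrite luniK lun_one runiK. Qed.

(** The hexagon with two unit factors, composed with [lun]; the invertible braiding is then
    cancelled. *)
Lemma lun_brd x : lun x ∘ brd x one = run x.
Proof.
apply: run_inj; apply: (mono_split (brdK x one)).
have := congr1 (fun h => lun _ ∘ h) (hexagon x one one).
rewrite -!cmpA (cmp_assoc_subst (lun_ten _ _)) (cmp_assoc_subst (lun_nat _)).
rewrite (cmp_assoc_subst (esym (brd_nat _ _))) -!cmpA triangle.
by rewrite (cmp_assoc_subst (lun_ten _ _)) tenmM cmp1m => ->.
Qed.

Lemma run_brd x : run x ∘ brd one x = lun x.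
Proof. by rewrite -lun_brd -cmpA brdK cmpm1. Qed.

Lemma brd_luni x : brd one x ∘ luni x = runi x.
Proof.
by apply: (mono_split (runK x)); rewrite cmpA run_brd luniK runiK.
Qed.

Lemma luni_nat x y (f : hom x y) : luni y ∘ f = (idm one ⊗₁ f) ∘ luni x.
Proof.
by apply: (mono_split (lunK y)); rewrite !cmpA luniK lun_nat -cmpA luniK cmpm1 cmp1m.
Qed.

Lemma runi_nat x y (f : hom x y) : runi y ∘ f = (f ⊗₁ idm one) ∘ runi x.
Proof.
by apply: (mono_split (runK y)); rewrite !cmpA runiK run_nat -cmpA runiK cmpm1 cmp1m.
Qed.

Lemma asci_nat x x' y y' z z' (f : hom x x') (g : hom y y') (h : hom z z') :
  asci x' y' z' ∘ (f ⊗₁ (g ⊗₁ h)) = ((f ⊗₁ g) ⊗₁ h) ∘ asci x y z.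
Proof.
apply: (mono_split (ascK x' y' z')).
by rewrite !cmpA asciK asc_nat -cmpA asciK cmpm1 cmp1m.
Qed.

Lemma asc_luni x y : asc one x y ∘ (luni x ⊗₁ idm y) = luni (x ⊗ y).
Proof.
apply: (mono_split (lunK _)).
by rewrite cmpA lun_ten tenmM !luniK cmp1m tenm1.
Qed.

Lemma asc_runi x y : asc x y one ∘ runi (x ⊗ y) = idm x ⊗₁ runi y.
Proof.
have e : (idm x ⊗₁ runi y) ∘ (idm x ⊗₁ run y) = idm _.
  by rewrite tenmM runK cmp1m tenm1.
apply: (mono_split e).
by rewrite cmpA run_ten tenmM !runiK cmp1m tenm1.
Qed.

Lemma asc_runi_luni x y : asc x one y ∘ (runi x ⊗₁ idm y) = idm x ⊗₁ luni y.
Proof.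
have e : (idm x ⊗₁ luni y) ∘ (idm x ⊗₁ lun y) = idm _.
  by rewrite tenmM lunK cmp1m tenm1.
apply: (mono_split e).
by rewrite cmpA triangle !tenmM runiK luniK !cmp1m.
Qed.

(** The middle part of [interchange], isolated so that its naturality and unit laws can be proved
    separately. *)
Definition tenCA x y z : hom (x ⊗ (y ⊗ z)) (y ⊗ (x ⊗ z)) :=
  asc y x z ∘ (brd x y ⊗₁ idm z) ∘ asci x y z.

Lemma tenCA_nat x x' y y' z z' (f : hom x x') (g : hom y y') (h : hom z z') :
  tenCA x' y' z' ∘ (f ⊗₁ (g ⊗₁ h)) = (g ⊗₁ (f ⊗₁ h)) ∘ tenCA x y z.
Proof.
rewrite /tenCA -!cmpA asci_nat tenmMA brd_nat cmp1m.
by rewrite (cmp_assoc_subst (esym (asc_nat _ _ _))) -cmpA tenmMA cmpm1.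
Qed.

Lemma interchange_nat (a a' b b' c c' d d' : C) (f : hom a a') (g : hom b b')
    (h : hom c c') (k : hom d d') :
  interchange a' b' c' d' ∘ ((f ⊗₁ g) ⊗₁ (h ⊗₁ k))
  = ((f ⊗₁ h) ⊗₁ (g ⊗₁ k)) ∘ interchange a b c d.
Proof.
rewrite /interchange -!/(tenCA _ _ _) -!cmpA asc_nat tenmMA tenCA_nat cmp1m.
by rewrite (cmp_assoc_subst (esym (asci_nat _ _ _))) -cmpA tenmMA cmpm1.
Qed.

Lemma tenCA_luni x y : tenCA x one y ∘ (idm x ⊗₁ luni y) = luni (x ⊗ y).
Proof.
have e : idm x ⊗₁ luni y = asc x one y ∘ (runi x ⊗₁ idm y).
  by rewrite asc_runi_luni.
rewrite e /tenCA -!cmpA (cmp_assoc_subst (ascK _ _ _)) cmp1m tenmM cmp1m.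
rewrite -asc_luni; congr (_ ∘ (_ ⊗₁ _)).
by rewrite -brd_luni cmpA brdK cmp1m.
Qed.

Lemma tenCA_runi y : tenCA one y one ∘ luni (y ⊗ one) = idm y ⊗₁ luni one.
Proof.
rewrite -asc_luni /tenCA -!cmpA (cmp_assoc_subst (ascK _ _ _)) cmp1m tenmM cmp1m.
by rewrite brd_luni asc_runi_luni.
Qed.

(** The two units created by a pair of post-compositions merge into one, the form in which
    [eten_name] applies. *)
Lemma interchange_luni x y :
  interchange one x one y ∘ (luni x ⊗₁ luni y)
  = (luni one ⊗₁ idm (x ⊗ y)) ∘ luni (x ⊗ y).
Proof.
rewrite -[X in X ⊗₁ luni y](cmpm1 (luni x)) -[X in _ ⊗₁ X](cmp1m (luni y)).
rewrite -tenmM /interchange -!/(tenCA _ _ _) -!cmpA.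
rewrite (cmp_assoc_subst (asc_luni x (one ⊗ y))).
rewrite (cmp_assoc_subst (esym (luni_nat _))) -cmpA.
rewrite tenCA_luni cmpA; congr (_ ∘ _).
by rewrite -asc_luni cmpA ascK cmp1m.
Qed.

Lemma interchange_runi x y :
  interchange x one y one ∘ (runi x ⊗₁ runi y)
  = (idm (x ⊗ y) ⊗₁ luni one) ∘ runi (x ⊗ y).
Proof.
rewrite -[X in X ⊗₁ runi y](cmpm1 (runi x)) -[X in _ ⊗₁ X](cmp1m (runi y)).
rewrite -tenmM /interchange -!/(tenCA _ _ _) -!cmpA.
rewrite (cmp_assoc_subst (asc_runi_luni _ _)) tenmMA cmp1m tenCA_runi.
rewrite (cmp_assoc_subst (asci_nat _ _ _)) -cmpA tenm1; congr (_ ∘ _).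
by rewrite -asc_runi cmpA ascK cmp1m.
Qed.
End Coherence.

(** * Pre- and post-composition on enriched homs *)

Section EnrichedCalculus.
Variables (C : csmc) (K : category) (E : enrichment C K).
Implicit Types x y z w : K.

Lemma name_inj x y (f g : hom x y) : name E f = name E g -> f = g.
Proof. by move=> e; rewrite -(nameK E f) e nameK. Qed.

Lemma epost1 x y : epost E x (idm y) = idm _.
Proof. by rewrite /epost name1 ecmp1m ?luniK //; exact: en_laws. Qed.

Lemma epre1 x y : epre E y (idm x) = idm _.
Proof. by rewrite /epre name1 ecmpm1 ?runiK //; exact: en_laws. Qed.

(** Associativity with the point [name E g] in the left slot. The next two lemmas put a named
    morphism in the right and in the middle slot; the latter is dinaturality of composition in its
    middle object. *)
Lemma epost_ecmp x y z w (g : hom z w) :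
  ecmp E x y w ∘ (epost E y g ⊗₁ idm _) = epost E x g ∘ ecmp E x y z.
Proof.
rewrite /epost !tenm_cmpl !cmpA -(ecmpA (en_laws E)) -!cmpA luni_nat.
rewrite (cmp_assoc_subst (asc_nat _ _ _)) -cmpA asc_luni !tenmMA cmp1m.
by rewrite !(tenm1, cmpm1, cmp1m).
Qed.

Lemma epre_ecmp x x' y z (f : hom x x') :
  ecmp E x y z ∘ (idm _ ⊗₁ epre E y f) = epre E z f ∘ ecmp E x' y z.
Proof.
rewrite /epre -!cmpA runi_nat tenmMA cmp1m cmpm1.
have -> : ecmp E x' y z ⊗₁ name E f
    = (ecmp E x' y z ⊗₁ idm _) ∘ (idm _ ⊗₁ name E f) by rewrite tenmM cmpm1 cmp1m.
rewrite !cmpA -(ecmpA (en_laws E)) -!cmpA -tenm1.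
rewrite (cmp_assoc_subst (asc_nat _ _ _)) -cmpA asc_runi.
by rewrite !tenmM !(cmpm1, cmp1m).
Qed.

Lemma epre_epost_ecmp x y y' z (f : hom y y') :
  ecmp E x y z ∘ (epre E z f ⊗₁ idm _) = ecmp E x y' z ∘ (idm _ ⊗₁ epost E x f).
Proof.
rewrite /epre /epost !tenm_cmpl !cmpA -(ecmpA (en_laws E)) -!cmpA.
rewrite (cmp_assoc_subst (asc_nat _ _ _)) -cmpA asc_runi_luni.
by rewrite !tenmM !(cmpm1, cmp1m).
Qed.

Lemma epost_name x y z (g : hom y z) (f : hom x y) :
  epost E x g ∘ name E f = name E (g ∘ f).
Proof.
by rewrite /epost name_cmp -!cmpA luni_nat tenmMA cmpm1 cmp1m.
Qed.

Lemma epre_name x y z (g : hom y z) (f : hom x y) :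
  epre E z f ∘ name E g = name E (g ∘ f).
Proof.
by rewrite /epre name_cmp -!cmpA runi_nat tenmMA cmpm1 cmp1m luni_one.
Qed.

Lemma epost_cmp x y z w (g : hom z w) (f : hom y z) :
  epost E x (g ∘ f) = epost E x g ∘ epost E x f.
Proof.
rewrite {1}/epost -epost_name tenm_cmpl !cmpA.
by rewrite epost_ecmp -!cmpA.
Qed.

Lemma epre_cmp x y z w (g : hom y z) (f : hom x y) :
  epre E w (g ∘ f) = epre E w f ∘ epre E w g.
Proof.
rewrite {1}/epre -epre_name tenm_cmpr !cmpA.
by rewrite epre_ecmp -!cmpA.
Qed.

Lemma epost_epre x x' y z (g : hom y z) (f : hom x x') :
  epost E x g ∘ epre E y f = epre E z f ∘ epost E x' g.
Proof.
rewrite /epost !cmpA -epre_ecmp -!cmpA luni_nat !tenmMA.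
by rewrite !(cmpm1, cmp1m) /epre -!cmpA.
Qed.

Lemma epost_id x y (f : hom x y) : epost E x f ∘ eid E x = name E f.
Proof. by rewrite -name1 epost_name cmpm1. Qed.

Lemma epre_id x y (f : hom x y) : epre E y f ∘ eid E y = name E f.
Proof. by rewrite -name1 epre_name cmp1m. Qed.
End EnrichedCalculus.

(** * Naturality of the enriched tensor product *)

Section EnrichedTensorProduct.
Variables (C : csmc) (K : smc) (E : enrichment C K) (em : enriched_monoidal E).
Implicit Types x y z w : K.

(** Compatibility of [eten] with composition, evaluated at two named morphisms whose names
    [eten_name] combines. *)
Lemma eten_epost x x' y y' z w (f : hom x x') (g : hom y y') :
  eten em z x' w y' ∘ (epost E z f ⊗₁ epost E w g)
  = epost E (z ⊗ w) (f ⊗₁ g) ∘ eten em z x w y.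
Proof.
rewrite /epost -!tenmM cmpA cmpA eten_cmp.
have := interchange_nat (name E f) (idm (ehom E z x)) (name E g) (idm (ehom E w y)).
have := interchange_luni (ehom E z x) (ehom E w y).
(* Both interchanges are abstracted, keeping only their two equations, so that reassociation cannot
   unfold them. *)
move: (interchange _ _ _ _) (interchange one _ _ _) => j i iE jE.
rewrite -!cmpA (cmp_assoc_subst jE) -cmpA iE.
rewrite luni_nat !tenmMA tenm1 !cmpm1 cmpA.
by rewrite (eten_name em) !cmpA !cmp1m.
Qed.

Lemma eten_epre x x' y y' z w (f : hom x x') (g : hom y y') :
  eten em x z y w ∘ (epre E z f ⊗₁ epre E w g)
  = epre E (z ⊗ w) (f ⊗₁ g) ∘ eten em x' z y' w.
Proof.
rewrite /epre -!tenmM cmpA cmpA eten_cmp.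
have := interchange_nat (idm (ehom E x' z)) (name E f) (idm (ehom E y' w))
  (name E g).
have := interchange_runi (ehom E x' z) (ehom E y' w).
move: (interchange _ _ _ _) (interchange _ one _ _) => j i iE jE.
rewrite -!cmpA (cmp_assoc_subst jE) -cmpA iE.
rewrite runi_nat !tenmMA tenm1 !cmpm1 cmpA.
by rewrite (eten_name em) !cmpA !cmp1m.
Qed.
End EnrichedTensorProduct.

(** * Currying in a closed category *)

Section Closed.
Variable C : csmc.
Implicit Types x y z : C.

Lemma uncurryK z x y (f : hom (z ⊗ x) y) : uncurry (curry f) = f.
Proof. exact: curryK. Qed.

Lemma uncurry_inj z x y (g h : hom z (ihom x y)) : uncurry g = uncurry h -> g = h.
Proof. by rewrite -{2}(curry_uniq g) -{2}(curry_uniq h) /uncurry => ->. Qed.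

Lemma curry_inj z x y (f g : hom (z ⊗ x) y) : curry f = curry g -> f = g.
Proof. by rewrite -{2}(uncurryK f) -{2}(uncurryK g) => ->. Qed.

Lemma uncurry_cmp z z' x y (g : hom z (ihom x y)) (k : hom z' z) :
  uncurry (g ∘ k) = uncurry g ∘ (k ⊗₁ idm x).
Proof. by rewrite /uncurry -cmpA tenmM cmpm1. Qed.

Lemma curry_cmp z z' x y (f : hom (z ⊗ x) y) (k : hom z' z) :
  curry f ∘ k = curry (f ∘ (k ⊗₁ idm x)).
Proof. by apply: uncurry_inj; rewrite uncurry_cmp !uncurryK. Qed.
End Closed.

(* Unlike [rewrite cmpA], which unifies up to delta, these do not unfold
   definitions whose body is a composite. *)
Ltac assocl := repeat rewrite -> cmpA.
Ltac assocr := repeat rewrite <- cmpA.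

(** * Transposition along tensors and cotensors, and naturality of the comparison maps *)

Section TensorCalculus.
Variables (C : csmc) (D : csm_ccat C).
Implicit Types (c : C) (x y z : D).
Local Notation E := (cd_enr D).

(** The passage inverse to [tensor_adj]. *)
Definition tensor_transpose c x y (f : hom (c ⊳ x) y) : hom c (Map x y) :=
  epost E x f ∘ tensor_eta c x.

(** At the point named by [f], the comparison morphism is the transpose of [f] up to currying and a
    unit isomorphism, so its invertibility yields a bijection of hom-sets. *)
Lemma tensor_cmp_name c x y (f : hom (c ⊳ x) y) :
  tensor_cmp (tensor_eta c x) y ∘ name E f = curry (tensor_transpose f ∘ lun c).
Proof.
rewrite /tensor_cmp curry_cmp; congr curry.
rewrite /tensor_transpose /epost -!cmpA tenmM cmp1m cmpm1.
by rewrite (cmp_assoc_subst (luni_nat _)) -!cmpA lunK tenmMA !(cmpm1, cmp1m).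
Qed.

Lemma tensor_transpose_inj c x y (f g : hom (c ⊳ x) y) :
  tensor_transpose f = tensor_transpose g -> f = g.
Proof.
move=> e; apply: (@name_inj C D E).
have [inv _] := act_invP (cd_tensors D) c x y.
by apply: (mono_split inv); rewrite [LHS]tensor_cmp_name e -tensor_cmp_name.
Qed.

Lemma tensor_adjK c x y (u : hom c (Map x y)) : tensor_transpose (tensor_adj u) = u.
Proof.
apply: (epi_split (luniK c)); apply: curry_inj.
rewrite -tensor_cmp_name /tensor_adj pointK cmpA.
by have [_ ->] := act_invP (cd_tensors D) c x y; rewrite cmp1m.
Qed.

Lemma tensor_transpose_cmp c x y z (g : hom y z) (f : hom (c ⊳ x) y) :
  tensor_transpose (g ∘ f) = epost E x g ∘ tensor_transpose f.
Proof. by rewrite /tensor_transpose epost_cmp cmpA. Qed.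

(** The equation defining [h ⊳₁ k], read as naturality of the unit [tensor_eta]. *)
Lemma epost_eta c c' x x' (h : hom c c') (k : hom x x') :
  epost E x (h ⊳₁ k) ∘ tensor_eta c x = epre E _ k ∘ tensor_eta c' x' ∘ h.
Proof. exact: tensor_adjK. Qed.

Lemma tensor_transpose_map c c' x x' y (f : hom (c' ⊳ x') y) (h : hom c c')
    (k : hom x x') :
  tensor_transpose (f ∘ (h ⊳₁ k)) = epre E y k ∘ tensor_transpose f ∘ h.
Proof.
rewrite tensor_transpose_cmp tensor_adjK; assocl.
by rewrite epost_epre /tensor_transpose; assocr.
Qed.

Lemma tensor_map1 c x : idm c ⊳₁ idm x = idm (c ⊳ x).
Proof.
apply: tensor_transpose_inj; rewrite tensor_adjK epre1.
by rewrite /tensor_transpose epost1 !(cmpm1, cmp1m).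
Qed.

Lemma tensor_mapM c c' c'' x x' x'' (h' : hom c' c'') (h : hom c c')
    (k' : hom x' x'') (k : hom x x') :
  (h' ⊳₁ k') ∘ (h ⊳₁ k) = (h' ∘ h) ⊳₁ (k' ∘ k).
Proof.
apply: tensor_transpose_inj; rewrite tensor_transpose_map !tensor_adjK epre_cmp.
by rewrite !cmpA.
Qed.

Lemma tensor_map_cmpr c c' x x' x'' (h : hom c c') (k' : hom x' x'') (k : hom x x') :
  h ⊳₁ (k' ∘ k) = (h ⊳₁ k') ∘ (idm c ⊳₁ k).
Proof. by rewrite tensor_mapM cmpm1. Qed.

Lemma tensor_map_comm c c' x x' (h : hom c c') (k : hom x x') :
  (h ⊳₁ idm x') ∘ (idm c ⊳₁ k) = (idm c' ⊳₁ k) ∘ (h ⊳₁ idm x).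
Proof. by rewrite !tensor_mapM !(cmpm1, cmp1m). Qed.

Lemma tensor_asc_nat c c' x x' (f : hom x x') :
  tensor_asc c c' x' ∘ (idm (c ⊗ c') ⊳₁ f)
  = (idm c ⊳₁ (idm c' ⊳₁ f)) ∘ tensor_asc c c' x.
Proof.
apply: tensor_transpose_inj.
rewrite tensor_transpose_map tensor_transpose_cmp !tensor_adjK cmpm1.
assocl; rewrite -epre_ecmp -epost_ecmp; assocr;
  rewrite !tenmM !cmp1m !epost_eta !cmpm1.
(* Both sides are now composites of two units; [idm c' ⊳₁ f] is moved across the middle object of
   [ecmp]. *)
rewrite -[X in _ = ecmp _ _ _ _ ∘ (_ ⊗₁ X)]cmp1m -tenmM; assocl;
  rewrite epre_epost_ecmp.
by assocr; rewrite tenmM cmp1m epost_eta cmpm1.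
Qed.

(** After transposition both sides are [eten] applied to a modified unit and to the name of [g]. *)
Lemma tensor_l_nat c x x' y y' (f : hom x x') (g : hom y y') :
  tensor_l c x' y' ∘ (idm c ⊳₁ (f ⊗₁ g)) = ((idm c ⊳₁ f) ⊗₁ g) ∘ tensor_l c x y.
Proof.
apply: tensor_transpose_inj.
rewrite tensor_transpose_map tensor_transpose_cmp !tensor_adjK cmpm1.
assocl; rewrite -eten_epre -eten_epost; assocr; rewrite !tenmMA epre_id epost_id.
by rewrite epost_eta cmpm1.
Qed.

Lemma tensor_r_nat c x x' y y' (f : hom x x') (g : hom y y') :
  tensor_r c x' y' ∘ (idm c ⊳₁ (f ⊗₁ g)) = (f ⊗₁ (idm c ⊳₁ g)) ∘ tensor_r c x y.
Proof.
rewrite /tensor_r; assocr; rewrite tensor_mapM brd_nat -tensor_mapM.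
rewrite (cmp_assoc_subst (tensor_l_nat _ _ _)); assocr.
by rewrite (cmp_assoc_subst (brd_nat _ _)); assocr.
Qed.

Lemma euncurry_epre z z' x y (f : hom z z') :
  euncurry (cd_mon D) z x y ∘ epre E (ihom x y) f
  = epre E y (f ⊗₁ idm x) ∘ euncurry (cd_mon D) z' x y.
Proof.
rewrite /euncurry; assocr; rewrite runi_nat tenmMA cmp1m cmpm1; assocl;
  rewrite -epost_epre; assocr.
by rewrite (cmp_assoc_subst (esym (eten_epre _ _ _ _ _))); assocr;
  rewrite tenmMA epre1 !cmp1m cmpm1.
Qed.

(** Here [curry (g ∘ ev x y)] is the action of the internal hom on [g]. *)
Lemma euncurry_epost z x y y' (g : hom y y') :
  euncurry (cd_mon D) z x y' ∘ epost E z (curry (g ∘ ev x y))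
  = epost E (z ⊗ x) g ∘ euncurry (cd_mon D) z x y.
Proof.
rewrite /euncurry; assocr; rewrite runi_nat tenmMA cmp1m cmpm1; assocl;
  rewrite -epost_cmp.
rewrite -[in RHS](curryK (g ∘ ev x y)) epost_cmp; assocr.
rewrite (cmp_assoc_subst (esym (eten_epost _ _ _ _ _))); assocr; rewrite tenmMA.
by rewrite epost1 !cmp1m ?cmpm1.
Qed.

(** Naturality passes from [euncurry] to its inverse. *)
Lemma ecurry_epre z z' x y (f : hom z z') :
  epre E (ihom x y) f ∘ cd_ecurry z' x y
  = cd_ecurry z x y ∘ epre E y (f ⊗₁ idm x).
Proof.
have [inv _] := cd_ecurryP z x y; apply: (mono_split inv).
have [_ invr] := cd_ecurryP z x y; have [_ invr'] := cd_ecurryP z' x y.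
by assocl; rewrite invr euncurry_epre -cmpA invr' cmpm1 cmp1m.
Qed.

Lemma ecurry_epost z x y y' (g : hom y y') :
  epost E z (curry (g ∘ ev x y)) ∘ cd_ecurry z x y
  = cd_ecurry z x y' ∘ epost E (z ⊗ x) g.
Proof.
have [inv invr] := cd_ecurryP z x y'; apply: (mono_split inv).
have [_ invr'] := cd_ecurryP z x y.
by assocl; rewrite invr euncurry_epost -cmpA invr' cmpm1 cmp1m.
Qed.

(** Transposing through the internal hom and then through the tensor reduces the claim to naturality
    of [cd_ecurry] in its first and last variables. *)
Lemma tensor_li_nat c x x' y (f : hom x x') :
  tensor_li c x' y ∘ ((idm c ⊳₁ f) ⊗₁ idm y)
  = (idm c ⊳₁ (f ⊗₁ idm y)) ∘ tensor_li c x y.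
Proof.
set k := idm c ⊳₁ (f ⊗₁ idm y).
rewrite /tensor_li -uncurry_cmp.
(* Post-composition with [k] is carried inside [uncurry] as the action of the internal hom on
   [k]. *)
have -> z (u : hom z (ihom y (c ⊳ (x ⊗ y)))) :
    k ∘ uncurry u = uncurry (curry (k ∘ ev _ _) ∘ u).
  by rewrite uncurry_cmp uncurryK /uncurry cmpA.
congr uncurry; apply: tensor_transpose_inj.
rewrite tensor_transpose_map tensor_transpose_cmp !tensor_adjK cmpm1.
assocl; rewrite ecurry_epre ecurry_epost; assocr; congr (_ ∘ _).
by rewrite epost_eta cmpm1.
Qed.

Lemma cotensor_cmp_name c x y (g : hom x (cotensor c y)) :
  cotensor_cmp (pow_eps (cd_cotensors D) c y) x ∘ name E g
  = curry (epre E y g ∘ pow_eps (cd_cotensors D) c y ∘ lun c).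
Proof.
rewrite /cotensor_cmp curry_cmp; congr curry.
assocr; rewrite brd_nat tenmMA cmpm1 cmp1m /epre; assocr.
rewrite (cmp_assoc_subst (runi_nat _)); assocr; rewrite tenmMA cmpm1 cmp1m.
by rewrite -run_brd (cmp_assoc_subst (runK _)) cmp1m.
Qed.

(** The passage inverse to [cotensor_adj]. *)
Definition cotensor_transpose c x y (g : hom x (cotensor c y)) : hom (c ⊳ x) y :=
  cotensor_ev c y ∘ (idm c ⊳₁ g).

Lemma cotensor_transposeE c x y (g : hom x (cotensor c y)) :
  tensor_transpose (cotensor_transpose g)
  = epre E y g ∘ pow_eps (cd_cotensors D) c y.
Proof. by rewrite tensor_transpose_map tensor_adjK cmpm1. Qed.

Lemma cotensor_transpose_inj c x y (f g : hom x (cotensor c y)) :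
  cotensor_transpose f = cotensor_transpose g -> f = g.
Proof.
move=> /(congr1 (@tensor_transpose _ _ _)); rewrite !cotensor_transposeE => e.
apply: (@name_inj C D E).
have [inv _] := pow_invP (cd_cotensors D) c x y.
by apply: (mono_split inv); rewrite [LHS]cotensor_cmp_name e -cotensor_cmp_name.
Qed.

(** Tensor and cotensor both represent the maps from [c] to [Map x y]; the two comparison morphisms
    are matched there. *)
Lemma cotensor_adjK c x y (f : hom (c ⊳ x) y) :
  cotensor_transpose (cotensor_adj f) = f.
Proof.
apply: tensor_transpose_inj; rewrite cotensor_transposeE.
apply: (epi_split (luniK c)); apply: curry_inj.
rewrite -cotensor_cmp_name /cotensor_adj pointK -cmpA cmpA.
have [_ ->] := pow_invP (cd_cotensors D) c x y.
by rewrite cmp1m tensor_cmp_name.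
Qed.

Lemma cotensor_transpose_cmp c x x' y (g : hom x (cotensor c y)) (h : hom x' x) :
  cotensor_transpose (g ∘ h) = cotensor_transpose g ∘ (idm c ⊳₁ h).
Proof. by rewrite /cotensor_transpose -cmpA tensor_mapM cmpm1. Qed.

Lemma cotensor_transpose_map c c' x y y' (h : hom c c') (g : hom y y')
    (k : hom x (cotensor c' y)) :
  cotensor_transpose (cotensor_map h g ∘ k)
  = g ∘ cotensor_transpose k ∘ (h ⊳₁ idm x).
Proof.
rewrite cotensor_transpose_cmp cotensor_adjK /cotensor_transpose; assocr.
by rewrite !tensor_mapM !(cmpm1, cmp1m).
Qed.
End TensorCalculus.

(** * Products and equalizers as countable limits *)

Section Products.
Variables (T : countType) (K : category) (X : T -> K) (L : countable_limits K).

Lemma prod_liftE (x : K) (p : forall t, hom x (X t)) t :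
  prod_pr X L t ∘ prod_lift L p = p t.
Proof. exact: (lim_liftE (L (disc_functor X)) (disc_cone p) t). Qed.

Lemma prod_uniq (x : K) (f g : hom x (prod_ob X L)) :
  (forall t, prod_pr X L t ∘ f = prod_pr X L t ∘ g) -> f = g.
Proof. exact: (@lim_uniq _ _ _ (L (disc_functor X))). Qed.
End Products.

Section Equalizers.
Variables (K : category) (a b : K) (f g : hom a b) (L : countable_limits K).

Definition equalizer_in : hom (equalizer_ob f g L) a :=
  lim_pr (L (ppair_functor f g)) false.

(** Both parallel arrows carry the leg at [false] to the one leg at [true]. *)
Lemma equalizer_inE : f ∘ equalizer_in = g ∘ equalizer_in.
Proof.
have e (u : @hom ppair false true) := lim_cone (L (ppair_functor f g)) u.
exact: (etrans (e false) (esym (e true))).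
Qed.

Lemma equalizer_lift_cone (x : K) (p : hom x a) : f ∘ p = g ∘ p ->
  forall i j (u : @hom ppair i j),
    fmap (ppair_functor f g) u
      ∘ (if i as i return hom x (ppair_ob a b i) then f ∘ p else p)
    = if j as j return hom x (ppair_ob a b j) then f ∘ p else p.
Proof. by move=> e [] [] //= u; rewrite ?cmp1m //; case: u. Qed.

Definition equalizer_lift (x : K) (p : hom x a) (e : f ∘ p = g ∘ p) :
    hom x (equalizer_ob f g L) :=
  lim_lift (L (ppair_functor f g)) (equalizer_lift_cone e).

Lemma equalizer_liftE (x : K) (p : hom x a) (e : f ∘ p = g ∘ p) :
  equalizer_in ∘ equalizer_lift e = p.
Proof.
exact: (lim_liftE (L (ppair_functor f g)) (equalizer_lift_cone e) false).
Qed.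

Lemma equalizer_uniq (x : K) (h k : hom x (equalizer_ob f g L)) :
  equalizer_in ∘ h = equalizer_in ∘ k -> h = k.
Proof.
move=> e; apply: (@lim_uniq _ _ _ (L (ppair_functor f g))) => -[] //.
(* The leg at [true] factors through the leg at [false], so agreement on the latter suffices. *)
have c := lim_cone (L (ppair_functor f g)) (false : @hom ppair false true).
by rewrite -c -!cmpA; congr (_ ∘ _).
Qed.
End Equalizers.

(** * Naturality of the extension of a map along a cyclic map *)

Section Extend.
Variables (C : csmc) (D : csm_ccat C).
Variables (P : operad C) (A : algebra D P) (M : bimodule A).

Lemma insert_factor_nat (X X' a b c : D) (u : hom X X') :
  insert_factor X' a b c ∘ (u ⊗₁ idm (a ⊗ (b ⊗ c)))
  = (idm a ⊗₁ ((u ⊗₁ idm b) ⊗₁ idm c)) ∘ insert_factor X a b c.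
Proof.
have e : ((idm a ⊗₁ u) ⊗₁ idm (b ⊗ c)) ∘ (brd X a ⊗₁ idm (b ⊗ c))
    = (brd X' a ⊗₁ idm (b ⊗ c)) ∘ ((u ⊗₁ idm a) ⊗₁ idm (b ⊗ c)).
  by rewrite !tenmM brd_nat.
rewrite /insert_factor -[idm (a ⊗ (b ⊗ c))]tenm1; assocr.
rewrite asci_nat (cmp_assoc_subst (esym e)); assocr.
rewrite (cmp_assoc_subst (asc_nat _ _ _)) -[idm (b ⊗ c)]tenm1; assocr.
by rewrite !tenmMA asci_nat.
Qed.

(** The map [inner] of [extend] with its objects, cut and action abstracted, so that naturality in
    [X] is proved without the combinatorics of fibres. *)
Definition extend_inner (Q : C) (X a b k l : D) (cut : hom l (a ⊗ (k ⊗ b)))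
    (y z : D) (act : hom (Q ⊳ k) y) (phi : hom (X ⊗ y) z) :
    hom (Q ⊳ (X ⊗ l)) (a ⊗ (z ⊗ b)) :=
  (idm a ⊗₁ (((phi ∘ (idm X ⊗₁ act) ∘ tensor_r Q X k) ⊗₁ idm b)
             ∘ tensor_l Q (X ⊗ k) b))
  ∘ tensor_r Q a ((X ⊗ k) ⊗ b)
  ∘ (idm Q ⊳₁ (insert_factor X a k b ∘ (idm X ⊗₁ cut))).

Lemma extend_inner_nat (Q : C) (X X' a b k l : D) (cut : hom l (a ⊗ (k ⊗ b)))
    (y z : D) (act : hom (Q ⊳ k) y) (phi : hom (X' ⊗ y) z) (u : hom X X') :
  extend_inner cut act (phi ∘ (u ⊗₁ idm y))
  = extend_inner cut act phi ∘ (idm Q ⊳₁ (u ⊗₁ idm l)).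
Proof.
have e1 : insert_factor X' a k b ∘ (idm X' ⊗₁ cut) ∘ (u ⊗₁ idm l)
    = (idm a ⊗₁ ((u ⊗₁ idm k) ⊗₁ idm b))
      ∘ (insert_factor X a k b ∘ (idm X ⊗₁ cut)).
assocl; rewrite -insert_factor_nat; assocr.
  by rewrite !tenmM !(cmpm1, cmp1m).
have e2 : phi ∘ (idm X' ⊗₁ act) ∘ tensor_r Q X' k ∘ (idm Q ⊳₁ (u ⊗₁ idm k))
    = phi ∘ (u ⊗₁ idm y) ∘ (idm X ⊗₁ act) ∘ tensor_r Q X k.
assocr; rewrite tensor_r_nat tensor_map1 tenmMA tenmMA.
  by rewrite !(cmpm1, cmp1m).
(* What remains concerns only the passage of [u] through the outer comparison maps, so the composite
   ending in [phi] is abstracted. *)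
rewrite /extend_inner -e2; move: (_ ∘ tensor_r Q X' k) => v.
assocr; rewrite tensor_mapM cmp1m; assocl; rewrite e1.
rewrite -[in RHS](cmp1m (idm Q)) -tensor_mapM.
assocr; rewrite (cmp_assoc_subst (tensor_r_nat _ _ _)); assocr.
rewrite tenmMA cmp1m; assocr; rewrite tensor_l_nat; assocl.
by rewrite tenmM cmp1m.
Qed.

(** The map [u] travels outward through the inner map, the associator and [tensor_li], each natural
    in this factor. Since any map is evaluation after its curried form, every extension is thereby
    determined by that of [ev]. *)
Lemma extend_nat m n (f : cycmap m n) (X X' : D) (u : hom X X')
    (phi : hom (X' ⊗ tpow A n) M) :
  extend f (phi ∘ (u ⊗₁ idm (tpow A n)))
  = extend f phi ∘ ((idm (Pmap P f) ⊳₁ u) ⊗₁ idm (tpow A m)).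
Proof.
rewrite /extend /= -!/(extend_inner _ _ _) extend_inner_nat tensor_map_cmpr.
assocr; rewrite tensor_li_nat (cmp_assoc_subst (tensor_map_comm _ _)); assocr.
by rewrite (cmp_assoc_subst (tensor_asc_nat _ _ _)); assocr.
Qed.
End Extend.

(** * Cotraces as maps into the equalizer *)

Section Representation.
Variables (C : csmc) (colC : countable_colimits C) (D : csm_ccat C).
Variables (P : operad C) (A : algebra D P) (M : bimodule A).

(** For [c = R n] this turns a component of a map into the hom object into the map [τ] of a
    cotrace. *)
Definition cobar_transpose (c : C) (B : D) n (k : hom B (cotensor c (cobar M n))) :
    hom ((c ⊳ B) ⊗ tpow A n) M :=
  uncurry (cotensor_transpose k).

Lemma cobar_transpose_inj c B n (k k' : hom B (cotensor c (cobar M n))) :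
  cobar_transpose k = cobar_transpose k' -> k = k'.
Proof. by move=> e; apply: cotensor_transpose_inj; apply: uncurry_inj. Qed.

Lemma cobar_transposeK c B n (t : hom ((c ⊳ B) ⊗ tpow A n) M) :
  cobar_transpose (cotensor_adj (curry t)) = t.
Proof. by rewrite /cobar_transpose cotensor_adjK uncurryK. Qed.

Lemma cobar_transpose_cmp c B B' n (k : hom B (cotensor c (cobar M n)))
    (g : hom B' B) :
  cobar_transpose (k ∘ g)
  = cobar_transpose k ∘ ((idm c ⊳₁ g) ⊗₁ idm (tpow A n)).
Proof. by rewrite /cobar_transpose cotensor_transpose_cmp uncurry_cmp. Qed.

Variables (R : DCP_presheaf colC P) (limD : countable_limits D).

Lemma restrict_source_transpose B (u : cyc_arrow)
    (k : hom B (cobar_src M R (tag u).1)) :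
  cobar_transpose (restrict_source M R u ∘ k)
  = cobar_transpose k
    ∘ ((presheaf_act R (tagged u) ⊳₁ idm B) ⊗₁ idm (tpow A (tag u).1)).
Proof.
by rewrite /cobar_transpose cotensor_transpose_map cmp1m uncurry_cmp.
Qed.

(** [cobar_act] is the curried extension of evaluation; naturality of the extension, applied to the
    cotensor transpose of [k], turns it into the extension of [cobar_transpose k]. *)
Lemma restrict_target_transpose B (u : cyc_arrow)
    (k : hom B (cobar_src M R (tag u).2)) :
  cobar_transpose (restrict_target M R u ∘ k)
  = extend (tagged u) (cobar_transpose k)
    ∘ ((tensor_asc (Pmap P (tagged u)) (R (tag u).2) B
        ∘ (brd (R (tag u).2) (Pmap P (tagged u)) ⊳₁ idm B))
       ⊗₁ idm (tpow A (tag u).1)).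
Proof.
rewrite /cobar_transpose /restrict_target; assocr; rewrite cotensor_transpose_map.
rewrite tensor_map1 cmpm1 cotensor_transpose_cmp cotensor_adjK.
assocr; rewrite tensor_map_comm.
(* Moving [k] past the associator brings it next to [cotensor_ev], where the two form
   [cotensor_transpose k]. *)
rewrite (cmp_assoc_subst (tensor_asc_nat _ _ _)); assocr.
rewrite (cmp_assoc_subst (tensor_mapM _ _ _ _)) cmp1m -/(cotensor_transpose k).
by rewrite uncurry_cmp uncurryK /uncurry extend_nat !tenm_cmpl; assocr.
Qed.

Definition parallel_source :=
  prod_lift limD (fun u => restrict_source M R u ∘ prod_pr (cobar_src M R) limD
    (tag u).1).
Definition parallel_target :=
  prod_lift limD (fun u => restrict_target M R u ∘ prod_pr (cobar_src M R) limD
    (tag u).2).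

Definition Hom_component n : hom (Hom_DCP_cobar M R limD) (cobar_src M R n) :=
  prod_pr (cobar_src M R) limD n
  ∘ equalizer_in parallel_source parallel_target limD.

Lemma Hom_component_uniq B (h h' : hom B (Hom_DCP_cobar M R limD)) :
  (forall n, Hom_component n ∘ h = Hom_component n ∘ h') -> h = h'.
Proof.
move=> e; apply: equalizer_uniq; apply: prod_uniq => n.
by have := e n; rewrite /Hom_component -!cmpA.
Qed.

Lemma Hom_component_compat (u : cyc_arrow) :
  restrict_source M R u ∘ Hom_component (tag u).1
  = restrict_target M R u ∘ Hom_component (tag u).2.
Proof.
have := congr1 (fun h => prod_pr (cobar_tgt M R) limD u ∘ h)
  (equalizer_inE parallel_source parallel_target limD).
by rewrite /parallel_source /parallel_target !cmpA !prod_liftE.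
Qed.

(** The universal property is stated with a sigma type so that its witness can define the inverse
    function. *)
Lemma Hom_lift B (k : forall n, hom B (cobar_src M R n)) :
  (forall u : cyc_arrow,
     restrict_source M R u ∘ k (tag u).1 = restrict_target M R u ∘ k (tag u).2) ->
  {h : hom B (Hom_DCP_cobar M R limD) | forall n, Hom_component n ∘ h = k n}.
Proof.
move=> kP.
have e : parallel_source ∘ prod_lift limD k = parallel_target ∘ prod_lift limD k.
  apply: prod_uniq => u.
  by rewrite !cmpA !prod_liftE; assocr; rewrite !prod_liftE.
exists (equalizer_lift limD e) => n.
by rewrite -cmpA equalizer_liftE prod_liftE.
Qed.

(** A cotrace is a dependent family with a proof of compatibility, whence functional extensionality
    and proof irrelevance. *)
Lemma cotrace_ext B (t t' : cotrace M R B) : (forall n, t n = t' n) -> t = t'.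
Proof.
case: t t' => t tP [t' tP'] /= e.
have {}e : t = t' by exact: functional_extensionality_dep.
by subst t'; rewrite (proof_irrelevance _ tP tP').
Qed.

(** The equalizing condition, transposed on both sides. The cyclic map is packed as a [cyc_arrow] to
    match the index of the product. *)
Lemma cotrace_of_compat B (h : hom B (Hom_DCP_cobar M R limD)) (u : cyc_arrow) :
  cobar_transpose (Hom_component (tag u).1 ∘ h)
    ∘ ((presheaf_act R (tagged u) ⊳₁ idm B) ⊗₁ idm (tpow A (tag u).1))
  = extend (tagged u) (cobar_transpose (Hom_component (tag u).2 ∘ h))
    ∘ ((tensor_asc (Pmap P (tagged u)) (R (tag u).2) B
        ∘ (brd (R (tag u).2) (Pmap P (tagged u)) ⊳₁ idm B))
       ⊗₁ idm (tpow A (tag u).1)).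
Proof.
rewrite -restrict_source_transpose -restrict_target_transpose; assocl.
by rewrite Hom_component_compat.
Qed.

Definition cotrace_of B (h : hom B (Hom_DCP_cobar M R limD)) : cotrace M R B :=
  @Cotrace C colC D P A M R B (fun n => cobar_transpose (Hom_component n ∘ h))
    (fun m n f => cotrace_of_compat h (existT _ (m, n) f)).

Lemma cotrace_of_bij B : bijective (@cotrace_of B).
Proof.
(* Conversely, injectivity of transposition turns the cotrace condition back into the equalizing
   condition. *)
have compat (t : cotrace M R B) (u : cyc_arrow) :
    restrict_source M R u ∘ cotensor_adj (curry (t (tag u).1))
    = restrict_target M R u ∘ cotensor_adj (curry (t (tag u).2)).
  apply: cobar_transpose_inj.
  rewrite restrict_source_transpose restrict_target_transpose !cobar_transposeK.
  exact: (ct_compat t (tagged u)).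
pose lift (t : cotrace M R B) := @Hom_lift B (fun n => cotensor_adj (curry (t n)))
  (compat t).
exists (fun t => sval (lift t)) => [h|t].
- apply: Hom_component_uniq => n; case: (lift _) => /= h' ->.
  by apply: cobar_transpose_inj; rewrite cobar_transposeK.
- apply: cotrace_ext => n /=; case: (lift t) => /= h ->.
  exact: cobar_transposeK.
Qed.
End Representation.

Theorem lemma5p4 (C : csmc) (limC : countable_limits C)
  (colC : countable_colimits C) (D : csm_ccat C) (limD : countable_limits D)
  (colD : countable_colimits D) (P : operad C) (A : algebra D P)
  (M : bimodule A) (R : DCP_presheaf colC P) :
  exists Phi : forall B : D, hom B (Hom_DCP_cobar M R limD) -> cotrace M R B,
    (forall B : D, bijective (Phi B)) /\
    (forall (B B' : D) (g : hom B' B) (h : hom B (Hom_DCP_cobar M R limD))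
            (n : nat),
       Phi B' (h ∘ g) n
       = Phi B h n ∘ ((idm (R n) ⊳₁ g) ⊗₁ idm (tpow A n))).
Proof.
exists (@cotrace_of C colC D P A M R limD); split; first exact: cotrace_of_bij.
(* Components of [h ∘ g] are those of [h] precomposed with [g], and transposition is natural in its
   source. *)
by move=> B B' g h n; rewrite /= cmpA cobar_transpose_cmp.
Qed.
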